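(* Let $H$ be an infinitely divisible distribution supported on $[0,\infty)$ with Laplace transform $$\int_0^\infty e^{-\lambda y}H(dy)=\exp\Big\{-a\lambda-\int_0^\infty(1-e^{-\lambda y})\upsilon(dy)\Big\},$$ with Lévy spectral distribution $F$ and decomposition $H=H_1*H_2$ (as in the context). For some $0<T<\infty$ and all $k\ge1$, assume that $$\liminf_{x\to\infty}\frac{F^{*k}(x-t+\Delta_T)}{F^{*k}(x+\Delta_T)}\ge1\quad\text{for all } t>0 .$$ Further, suppose that $H_1(x+\Delta_T)=o\big(H_2(x+\Delta_T)\big)$ and $H\in\mathcal L_{\Delta_T}\cap\mathcal{OS}_{\Delta_T}$. Then $$H_2\in\mathcal L_{\Delta_T}\cap\mathcal{OS}_{\Delta_T}\quad\text{and}\quad H_2(x+\Delta_T)\approx H(x+\Delta_T).$$ Moreover, there exists an integer $n_0\ge1$ such that $F^{*n}\in\mathcal L_{\Delta_T}\cap\mathcal{OS}_{\Delta_T}$ for all $n\ge n_0$. Further, if $n_0\ge2$ and $F^{*l_0}\in\mathcal{OS}_{\Delta_T}$ for some $1\le l_0\le n_0-1$, then $F^{*n}\in\mathcal L_{\Delta_T}\cap\mathcal{OS}_{\Delta_T}$ for all $n\ge l_0$. In particular, if $l_0=1$, that is, $F\in\mathcal{OS}_{\Delta_T}$, then $F\in\mathcal L_{\Delta_T}\cap\mathcal{OS}_{\Delta_T}$.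
   Context: All limits are as $x\to\infty$. $V^{*k}$ is the $k$-fold convolution of $V$ with itself, $V^{*0}$ being degenerate at $0$. $f\approx g$ means $f=O(g)$ and $g=O(f)$; $f\sim g$ means $f/g\to1$. Any condition on a ratio as $x\to\infty$ presupposes that its denominator is positive for all sufficiently large $x$. Lévy data: $a\ge0$; $\upsilon$ is a Borel measure on $(0,\infty)$ with $\mu:=\upsilon((1,\infty))\in(0,\infty)$ and $\int_0^1y\,\upsilon(dy)<\infty$. The Lévy spectral distribution is $F(x)=\frac{\upsilon((1,x])}{\mu}\mathbf 1(x>1)$. The decomposition $H=H_1*H_2$ is the one with $H_2(x)=e^{-\mu}\sum_{k=0}^\infty F^{*k}(x)\mu^k/k!$ (so $H_2=F^{*\tau}$ with $\tau$ Poisson with mean $\mu$) and $H_1$ the infinitely divisible distribution with drift $a$ and Lévy measure $\upsilon$ restricted to $(0,1]$. Local notation: for $0<T<\infty$, $V(x+\Delta_T)=V((x,x+T])$; $V(x-t+\Delta_T)$ is the same with $x$ replaced by $x-t$. Classes (for fixed $0<T<\infty$): $V\in\mathcal L_{\Delta_T}$ if $V(x+\Delta_T)>0$ for all sufficiently large $x$ and $V(x-t+\Delta_T)\sim V(x+\Delta_T)$ for all $t>0$. $V\in\mathcal{OS}_{\Delta_T}$ if $\limsup V^{*2}(x+\Delta_T)/V(x+\Delta_T)<\infty$. *)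

(* Defs.v *)
From HB Require Import structures.
From mathcomp Require Import all_boot all_order all_algebra.
From mathcomp Require Import all_classical all_reals all_analysis measurable_realfun.

Set Implicit Arguments.
Unset Strict Implicit.
Unset Printing Implicit Defensive.

Import Order.TTheory GRing.Theory Num.Def Num.Theory.
Import numFieldNormedType.Exports.

Local Open Scope classical_set_scope.
Local Open Scope ring_scope.

(* Distributions are Borel probability measures on the line, and a
   distribution on [0, +oo) is one that gives no mass to ]-oo, 0[. *)
Notation distr R := (probability (measurableTypeR R) R).

Section distributions.
Context {R : realType}.
Implicit Types V W : distr R.

Definition sumR (z : measurableTypeR R * measurableTypeR R) : measurableTypeR R :=
  z.1 + z.2.

Lemma measurable_sumR : measurable_fun setT sumR.
Proof. exact: measurable_funD. Qed.

HB.instance Definition _ := isMeasurableFun.Build _ _ _ _ sumR measurable_sumR.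

Definition convolution V W : distr R := distribution (V \x W)%E sumR.

Fixpoint convolution_pow V n : distr R :=
  if n is n'.+1 then convolution V (convolution_pow V n') else \d_(0 : measurableTypeR R).

(* Measures are only meaningful, hence only compared, on Borel sets. *)
Definition eq_distr V W := forall A, measurable A -> V A = W A.

End distributions.

Section compound_poisson.
Context {R : realType} (m : {nonneg R}) (V : distr R).
Local Open Scope ereal_scope.

Definition compound_poisson (A : set (measurableTypeR R)) : \bar R :=
  (expR (- m%:num))%:E *
  \sum_(0 <= k <oo) (m%:num ^+ k / k`!%:R)%:E * convolution_pow V k A.

Let w (k : nat) : {nonneg R} :=
  NngNum (divr_ge0 (exprn_ge0 k (ge0 m)) (ler0n R k`!)).
Let mixture : {measure set (measurableTypeR R) -> \bar R} :=
  mscale (NngNum (expR_ge0 (- m%:num))) (mseries (fun k => mscale (w k) (convolution_pow V k)) 0).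

Let compound_poisson0 : compound_poisson set0 = 0.
Proof. exact: (measure0 mixture). Qed.

Let compound_poisson_ge0 A : 0 <= compound_poisson A.
Proof. exact: (measure_ge0 mixture). Qed.

Let compound_poisson_sigma_additive : semi_sigma_additive compound_poisson.
Proof. exact: (@measure_semi_sigma_additive _ _ _ mixture). Qed.

HB.instance Definition _ := isMeasure.Build _ _ _ compound_poisson
  compound_poisson0 compound_poisson_ge0 compound_poisson_sigma_additive.

Let compound_poisson_setT : compound_poisson [set: _] = 1.
Proof.
rewrite /compound_poisson.
under eq_eseriesr do rewrite probability_setT mule1.
rewrite [X in _ * X](_ : _ = (expR m%:num)%:E); last first.
  rewrite expRE -EFin_lim; last first.
    rewrite /pseries/=; under eq_fun do rewrite mulrC.
    exact: is_cvg_series_exp_coeff.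
  apply/congr_lim/funext => n/=; rewrite /pseries/= /series/= -sumEFin//.
  by under eq_bigr do rewrite mulrC.
by rewrite -EFinM expRN mulVf ?gt_eqF ?expR_gt0.
Qed.

HB.instance Definition _ :=
  Measure_isProbability.Build _ _ _ compound_poisson compound_poisson_setT.

End compound_poisson.

Section levy.
Context {R : realType}.
Implicit Types (a : R) (nu : {measure set (measurableTypeR R) -> \bar R})
  (V : distr R).
Local Open Scope ereal_scope.

Definition infinitely_divisible V :=
  forall n, (1 <= n)%N -> exists W : distr R, eq_distr V (convolution_pow W n).

Definition laplace V (l : R) : \bar R :=
  \int[V]_(y in `[0%R, +oo[) (expR (- (l * y)))%:E.

(* V is the infinitely divisible distribution on [0, +oo) with drift a and
   Levy measure nu on ]0, +oo[. *)
Definition inf_div_law a nu V :=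
  [/\ infinitely_divisible V, V `]-oo, 0%R[%classic = 0 &
      forall l : R, (0 <= l)%R ->
        laplace V l =
        expeR (- (a * l)%:E - \int[nu]_(y in `]0%R, +oo[) (1 - expR (- (l * y)))%:E)].

(* A measure on ]0, +oo[ is a measure on the line carried by ]0, +oo[. *)
Definition levy_data a nu :=
  [/\ (0 <= a)%R, nu `]-oo, 0%R]%classic = 0,
      0 < nu `]1%R, +oo[%classic < +oo & \int[nu]_(y in `]0%R, 1%R]) y%:E < +oo].

Definition levy_mass nu : {nonneg R} :=
  NngNum (fine_ge0 (measure_ge0 nu `]1%R, +oo[%classic)).

Definition small_jumps nu : {measure set (measurableTypeR R) -> \bar R} :=
  mrestr nu (measurable_itv `]0%R, 1%R]).

(* A |-> nu (A `&` ]1, +oo[) / nu ]1, +oo[; the second argument of mnormalize is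
   a default value that is not used when 0 < nu ]1, +oo[ < +oo. *)
Definition levy_spectral nu : distr R :=
  mnormalize (mrestr nu (measurable_itv `]1%R, +oo[)) \d_(0%R : measurableTypeR R).

End levy.

Section local_classes.
Context {R : realType} (T : R).
Implicit Types V : distr R.

(* V (x + Delta_T), where Delta_T = ]0, T] *)
Definition loc V (x : R) : R := fine (V `]x, x + T]%classic).

(* A condition on a ratio at +oo includes that its denominator is eventually
   positive; without this, x / 0 = 0 could make it hold vacuously. *)
Definition loc_pos V := \forall x \near +oo, 0 < loc V x.

Definition class_L V :=
  loc_pos V /\
  forall t : R, 0 < t -> loc V (x - t) / loc V x @[x --> +oo] --> (1 : R).

Definition class_OS V :=
  loc_pos V /\
  (limf_esup (fun x => (loc (convolution_pow V 2) x / loc V x)%:E) +oo_R < +oo)%E.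

Definition class_LOS V := class_L V /\ class_OS V.

Definition loc_liminf_ge1 V :=
  loc_pos V /\
  forall t : R, 0 < t ->
    (1 <= limf_einf (fun x => (loc V (x - t) / loc V x)%:E) +oo_R)%E.

End local_classes.

(* The Landau notations need the filter +oo in bundled form. *)
Canonical pinfty_filterType (R : realType) : filter_on R :=
  FilterType (pinfty_nbhs R) _.

Definition asymp_equiv {R : realType} (f g : R -> R) :=
  f =O_ (pinfty_nbhs R) g /\ g =O_ (pinfty_nbhs R) f.

(* Main.v *)
Require Import Defs.
From mathcomp Require Import all_boot all_order all_algebra.
From mathcomp Require Import all_classical all_reals all_analysis.
From mathcomp Require Import measurable_realfun ring lra.

Set Implicit Arguments.
Unset Strict Implicit.
Unset Printing Implicit Defensive.

Import Order.TTheory GRing.Theory Num.Def Num.Theory.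
Import numFieldNormedType.Exports.

Local Open Scope classical_set_scope.
Local Open Scope ring_scope.

(** Write [f_k], [h], [h1], [h2] for the probabilities that the [k]-th convolution power
    of [F], and [H], [H1], [H2] respectively, give to the window ]x, x + T]. The
    hypothesis on [F] says that each [f_k] is asymptotically non-increasing, with no
    uniformity in the shift or in [k]. The idea is to measure everything against [h],
    which is insensitive to shifts and whose convolution square is O(h), and to
    transfer the regularity of [h] down the decomposition H = H1 * H2 and then down the
    Poisson series.

    Upper bounds. One jump occurs with positive probability, so [H] is at least a
    multiple of [H1 * F]; as [f_1] is asymptotically non-increasing, f_1 = O(h)
    ([loc_dom_F]). A Kesten bound [f_k <= C B^k h], with one threshold for all [k]
    ([loc_kesten]), then gives h2 = O(h), and bounds the tail of the Poisson series by an
    arbitrarily small multiple of [h]. Therefore [h2] too is asymptotically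
    non-increasing, up to o(h) ([loc_decr_H2]).

    Transfer to [H2]. Since h1 = o(h2), large values of the first summand contribute
    o(h) ([H1_tail]). Up to that, [h] is an average of [h2] over a bounded block of
    shifts. As [h] is insensitive to shifts and [h2] is almost non-increasing, this gives
    h = O(h2) ([loc_dom_H]); a drop of [h2] would persist under widening its
    interval and produce a drop of [h], so [h2] varies by o(h) under any shift
    ([loc_incr_H2]). The liminf conditions, known for each shift separately, are made
    uniform off small sets by convergence in measure ([prob_near_lt]).

    Transfer to the powers of [F]. The increments of [h2] are o(h) and are weighted sums
    of increments of the [f_k], which are almost of one sign; so each is o(h)
    ([loc_asymp_cst_Fk]). As f_k = O(f_(k+1)) and a partial sum of the Poisson series
    carries half of [h], some [f_n] satisfies h = O(f_n) ([ex_loc_dom_H_Fk]). A power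
    with h = O(f_n) has the same order as [h], and inherits both class memberships
    ([class_LOS_of_dom]). If the [l]-th power is in OS, then every power of [F] is
    O(f_l), hence so is [h], and the same argument applies from [l] on
    ([class_LOS_Fk_of_OS]). *)

(** * Means of bounded measurable functions *)

Section bounded_measurable.
Context {d : measure_display} {S : measurableType d} {R : realType}.
Implicit Types (V : probability S R) (f g : S -> R) (A : set S).

(** Under a probability, boundedness makes all means finite, so the estimates below
    are inequalities between real numbers rather than between extended ones. *)
Definition bmeas f := measurable_fun setT f /\ exists M, forall y, `|f y| <= M.

Lemma bmeasD f g : bmeas f -> bmeas g -> bmeas (fun y => f y + g y).
Proof.
move=> [mf [M hM]] [mg [N hN]]; split; first exact: measurable_funD.
exists (M + N) => y; rewrite (le_trans (ler_normD _ _))// lerD//.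
Qed.

Lemma bmeasM f g : bmeas f -> bmeas g -> bmeas (fun y => f y * g y).
Proof.
move=> [mf [M hM]] [mg [N hN]]; split; first exact: measurable_funM.
by exists (M * N) => y; rewrite normrM ler_pM.
Qed.

Lemma bmeas_cst (c : R) : bmeas (fun=> c).
Proof. by split; [exact: measurable_cst|exists `|c|]. Qed.

Lemma bmeas_indic A : measurable A -> bmeas \1_A.
Proof.
move=> mA; split; first exact: measurable_indic.
by exists 1 => y; rewrite indicE ger0_norm ?ler0n// lern1; case: (_ \in _).
Qed.

Lemma bmeas_integrable V f : bmeas f -> V.-integrable setT (EFin \o f).
Proof.
move=> [mf [M hM]]; have V1 : (V setT < +oo)%E by rewrite probability_setT ltry.
apply: (measurable_bounded_integrable measurableT V1 mf).
by exists M; split; rewrite ?num_real// => x Mx y _; exact: le_trans (hM y) (ltW Mx).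
Qed.

Lemma meanD V f g : bmeas f -> bmeas g ->
  (\int[V]_y (f y + g y) = \int[V]_y f y + \int[V]_y g y)%R.
Proof. by move=> bf bg; rewrite RintegralD//; exact: bmeas_integrable. Qed.

Lemma meanZ V f (c : R) : bmeas f -> (\int[V]_y (c * f y) = c * \int[V]_y f y)%R.
Proof. by move=> bf; rewrite RintegralZl//; exact: bmeas_integrable. Qed.

Lemma mean_cst V (c : R) : (\int[V]_y c = c)%R.
Proof. by rewrite Rintegral_cst// [X in fine X](probability_setT V) mulr1. Qed.

Lemma mean_indic V A : measurable A ->
  (\int[V]_y \1_A y = fine (V A))%R.
Proof. by move=> mA; rewrite /Rintegral integral_indic// setIT. Qed.

(** The mean does not see a null set, so there the bound can be restored by adding
    a multiple of its indicator to [g]. *)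
Lemma le_mean_supp V A f g : measurable A -> V A = 0%E -> bmeas f -> bmeas g ->
  (forall y, ~ A y -> f y <= g y) -> (\int[V]_y f y <= \int[V]_y g y)%R.
Proof.
move=> mA VA bf bg fg; have bi := bmeas_indic mA.
have [[_ [M hM]] [_ [N hN]]] := (bf, bg).
have bc := bmeasM (bmeas_cst (M + N)) bi.
have -> : (\int[V]_y g y = \int[V]_y (g y + (M + N) * \1_A y))%R.
  by rewrite meanD// meanZ// mean_indic// VA/= mulr0 addr0.
apply: le_Rintegral => //; [exact: bmeas_integrable| |].
  by apply: bmeas_integrable; exact: bmeasD.
move=> y _; have [Ay|nAy] := pselect (A y); last first.
  by rewrite (le_trans (fg _ nAy))// lerDl mulr_ge0 ?ler0n// addr_ge0//;
    [exact: le_trans (hM y)|exact: le_trans (hN y)].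
rewrite indicE mem_set// mulr1.
have := hM y; have := hN y; rewrite !ler_norml => /andP[+ +] /andP[+ +]; lra.
Qed.

Lemma le_mean V f g : bmeas f -> bmeas g -> (forall y, f y <= g y) ->
  (\int[V]_y f y <= \int[V]_y g y)%R.
Proof.
move=> bf bg fg; apply: le_Rintegral => //; exact: bmeas_integrable.
Qed.

End bounded_measurable.

Section probability_facts.
Context {d : measure_display} {S : measurableType d} {R : realType}.
Implicit Types (V : probability S R) (A B : set S).

Lemma EFin_prob V A : measurable A -> ((fine (V A))%:E = V A)%E.
Proof. by move=> mA; rewrite fineK// fin_num_measure. Qed.

Lemma fine_prob_ge0 V A : 0 <= fine (V A).
Proof. exact/fine_ge0/measure_ge0. Qed.

Lemma fine_prob_le1 V A : measurable A -> fine (V A) <= 1.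
Proof. by move=> mA; rewrite -lee_fin EFin_prob//; exact: probability_le1. Qed.

Lemma fine_prob_le V A B : measurable A -> measurable B -> A `<=` B ->
  fine (V A) <= fine (V B).
Proof.
by move=> mA mB AB; rewrite -lee_fin !EFin_prob//; apply: le_measure => //; rewrite inE.
Qed.

Lemma fine_prob_leU V A B : measurable A -> measurable B ->
  fine (V (A `|` B)) <= fine (V A) + fine (V B).
Proof.
move=> mA mB; rewrite -lee_fin EFinD !EFin_prob//; last exact: measurableU.
exact: measureU2.
Qed.

End probability_facts.

Section product_sections.
Context {d1 d2 : measure_display} {S1 : measurableType d1} {S2 : measurableType d2}
  {R : realType} (V : probability S1 R) (W : probability S2 R).
Context (E : set (S1 * S2)) (mE : measurable E).

Lemma bmeas_xsection : bmeas (fun y => fine (W (xsection E y))).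
Proof.
split; first exact: measurableT_comp (measurable_fun_xsection _ mE).
exists 1 => y; rewrite ger0_norm ?fine_prob_ge0// fine_prob_le1//.
exact: measurable_xsection.
Qed.

Lemma bmeas_ysection : bmeas (fun z => fine (V (ysection E z))).
Proof.
split; first exact: measurableT_comp (measurable_fun_ysection _ mE).
exists 1 => y; rewrite ger0_norm ?fine_prob_ge0// fine_prob_le1//.
exact: measurable_ysection.
Qed.

Lemma fine_prodE :
  fine ((V \x W)%E E) = (\int[V]_y fine (W (xsection E y)))%R.
Proof.
rewrite /Rintegral; congr fine; rewrite /product_measure1; apply: eq_integral => y _.
by rewrite /= EFin_prob//; exact: measurable_xsection.
Qed.

(** Tonelli for an indicator: slicing an event of the product along either factor
    gives its probability. It yields the commutativity of the convolution, and it
    moves the role of the integrator from one summand to the other. *)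
Lemma mean_sections : (\int[V]_y fine (W (xsection E y)) =
  \int[W]_z fine (V (ysection E z)))%R.
Proof.
rewrite -fine_prodE (@product_measure_unique _ _ _ _ _ V W (V \x^ W)%E)//.
  rewrite /Rintegral; congr fine; rewrite /product_measure2; apply: eq_integral => y _.
  by rewrite /= EFin_prob//; exact: measurable_ysection.
by move=> A B mA mB; exact: product_measure2E.
Qed.

End product_sections.

(** * Convolutions seen through the window ]x, x + T] *)

Section convolution_facts.
Context {R : realType} (T : R).
Implicit Types (V W : distr R) (x y s t : R).

Lemma measurable_sum_preimage (A : set (measurableTypeR R)) : measurable A ->
  measurable ((@sumR R) @^-1` A).
Proof. by move=> mA; rewrite -[X in measurable X]setTI; exact: measurable_sumR. Qed.

Lemma xsection_sum (A : set (measurableTypeR R)) (y : measurableTypeR R) :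
  xsection ((@sumR R) @^-1` A) y = [set z | A (y + z)].
Proof. by apply/seteqP; split => z; rewrite /xsection/= inE. Qed.

Lemma ysection_sum (A : set (measurableTypeR R)) (z : measurableTypeR R) :
  ysection ((@sumR R) @^-1` A) z = [set y | A (y + z)].
Proof. by apply/seteqP; split => y; rewrite /ysection/= inE. Qed.

Lemma shift_window x y : [set z | (`]x, x + T]%classic : set R) (y + z)] =
  `]x - y, x - y + T]%classic.
Proof. by apply/seteqP; split => z/=; rewrite !in_itv/= => /andP[? ?]; lra. Qed.

Lemma loc_ge0 V x : 0 <= loc T V x.
Proof. exact: fine_prob_ge0. Qed.

Lemma loc_le1 V x : loc T V x <= 1.
Proof. apply: fine_prob_le1; exact: measurable_itv. Qed.

Lemma bmeas_loc W x : bmeas (fun y : measurableTypeR R => loc T W (x - y)).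
Proof.
pose E := (@sumR R) @^-1` (`]x, x + T]%classic : set (measurableTypeR R)).
have mE : measurable E by apply: measurable_sum_preimage; exact: measurable_itv.
have := bmeas_xsection W mE; congr bmeas; apply/funext => y.
by rewrite xsection_sum shift_window.
Qed.

Lemma le_mean_halfline V s (f g : measurableTypeR R -> R) :
  V `]-oo, s[%classic = 0%E -> bmeas f -> bmeas g ->
  (forall y, s <= y -> f y <= g y) -> (\int[V]_y f y <= \int[V]_y g y)%R.
Proof.
move=> Vs bf bg fg.
have := @le_mean_supp _ _ _ V _ f g (measurable_itv `]-oo, s[) Vs bf bg; apply.
by move=> y /=; rewrite in_itv/= => /negP; rewrite -leNgt; exact: fg.
Qed.

Lemma convolutionE V W (A : set (measurableTypeR R)) : measurable A ->
  fine (convolution V W A) = (\int[V]_y fine (W [set z | A (y + z)]))%R.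
Proof.
move=> mA; rewrite /convolution/= /distribution/= /pushforward/=.
rewrite fine_prodE; last exact: measurable_sum_preimage.
by apply: eq_Rintegral => y _; rewrite xsection_sum.
Qed.

(** Conditioning on the first summand reduces a window of the sum to a shifted
    window of the second summand. *)
Lemma loc_conv V W x :
  loc T (convolution V W) x = (\int[V]_y loc T W (x - y))%R.
Proof.
rewrite {1}/loc convolutionE; last exact: measurable_itv.
by apply: eq_Rintegral => y _; rewrite shift_window.
Qed.

Lemma loc_convC V W x : loc T (convolution V W) x = loc T (convolution W V) x.
Proof.
pose E := (@sumR R) @^-1` (`]x, x + T]%classic : set (measurableTypeR R)).
have mE : measurable E by apply: measurable_sum_preimage; exact: measurable_itv.
have := mean_sections V W mE; rewrite !loc_conv => H.
transitivity (\int[V]_y fine (W (xsection E y)))%R.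
  by apply: eq_Rintegral => y _; rewrite xsection_sum shift_window.
rewrite H; apply: eq_Rintegral => y _; rewrite ysection_sum /loc.
by rewrite -shift_window; congr (fine (V _)); apply/seteqP; split => z /=; rewrite addrC.
Qed.

Lemma convolution_null V W s t : V `]-oo, s[%classic = 0%E ->
  W `]-oo, t[%classic = 0%E -> convolution V W `]-oo, s + t[%classic = 0%E.
Proof.
move=> Vs Wt; rewrite -EFin_prob; last exact: measurable_itv.
congr EFin; apply/eqP; rewrite eq_le fine_prob_ge0 andbT convolutionE; last exact: measurable_itv.
rewrite -[leRHS](mean_cst V 0).
pose E := (@sumR R) @^-1` (`]-oo, s + t[%classic : set (measurableTypeR R)).
have mE : measurable E by apply: measurable_sum_preimage; exact: measurable_itv.
apply: (le_mean_halfline Vs) => [||y sy].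
- by have := bmeas_xsection W mE; congr bmeas; apply/funext => y; rewrite xsection_sum.
- exact: bmeas_cst.
rewrite (_ : 0 = fine (W `]-oo, t[%classic)); last by rewrite Wt.
apply: fine_prob_le.
- by have := measurable_xsection y mE; rewrite xsection_sum.
- exact: measurable_itv.
- by move=> z/=; rewrite !in_itv/=; lra.
Qed.

Lemma loc_eq0 V s x : V `]-oo, s[%classic = 0%E -> x + T < s -> loc T V x = 0.
Proof.
move=> Vs xs; apply/eqP; rewrite eq_le loc_ge0 andbT.
rewrite (_ : 0 = fine (V `]-oo, s[%classic)); last by rewrite Vs.
apply: fine_prob_le; [exact: measurable_itv..|].
by move=> z/=; rewrite !in_itv/= => /andP[_ +]; lra.
Qed.

Lemma dirac_null : (\d_(0 : measurableTypeR R) : distr R) `]-oo, 0%R[%classic = 0%E.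
Proof. by rewrite /= diracE memNset//= in_itv/= ltxx. Qed.

Lemma loc_dirac x : 0 <= x -> loc T (\d_(0 : measurableTypeR R) : distr R) x = 0.
Proof.
move=> x0; rewrite /loc/= indicE memNset//= in_itv/= => /andP[]; lra.
Qed.

Lemma loc_conv_dirac V x :
  loc T (convolution V (\d_(0 : measurableTypeR R) : distr R)) x = loc T V x.
Proof.
rewrite loc_conv [RHS]/loc -mean_indic; last exact: measurable_itv.
apply: eq_Rintegral => y _; rewrite /loc/= !indicE; congr ((_ : bool)%:R).
by apply/idP/idP; rewrite !inE/= !in_itv/= => /andP[? ?]; lra.
Qed.

Lemma convolution_pow_null V s n : V `]-oo, s[%classic = 0%E -> 0 <= s ->
  (1 <= n)%N -> convolution_pow V n `]-oo, s[%classic = 0%E.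
Proof.
move=> Vs s0; have V0 k : convolution_pow V k `]-oo, 0%R[%classic = 0%E.
  elim: k => [|k IH]; first exact: dirac_null.
  rewrite /= -(addr0 0); apply: convolution_null => //.
  apply/eqP; rewrite eq_le measure_ge0 andbT -Vs.
  apply: le_measure; rewrite ?inE; [exact: measurable_itv..|].
  by move=> z/=; rewrite !in_itv/=; lra.
by case: n => // n _ /=; rewrite -[X in `]-oo, X[%classic](addr0 s); exact: convolution_null.
Qed.

End convolution_facts.

(** * Convergence in measure at infinity *)

Section neighbourhoods_of_infinity.
Context {R : realType}.

Lemma near_pinfty_ex (P : R -> Prop) : (\forall x \near +oo, P x) ->
  exists X, forall x, X <= x -> P x.
Proof.
move=> [M [_ HM]]; exists (M + 1) => x Mx; apply: HM; lra.
Qed.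

Lemma near_pinfty_shift (P : R -> Prop) (s : R) : (\forall x \near +oo, P x) ->
  \forall x \near +oo, P (x + s).
Proof.
move=> [M [_ HM]]; exists (M - s); split; rewrite ?num_real// => x Mx.
by apply: HM; lra.
Qed.

(** Pointwise convergence implies convergence in measure. It takes the place of
    Fatou's lemma: hypotheses such as the liminf condition hold for
    each shift separately, with no uniformity, and this lemma makes them uniform
    outside a set of small probability. Along a sequence tending to infinity, the
    exceptional sets have an empty limit superior. *)
Lemma prob_near_lt d (S : measurableType d) (V : probability S R)
    (E : R -> set S) (e : R) : (forall x, measurable (E x)) ->
  (forall y, \forall x \near +oo, ~ E x y) -> 0 < e ->
  \forall x \near +oo, fine (V (E x)) < e.
Proof.
move=> mE Ey e0.
suff : fine (V (E x)) @[x --> +oo] --> (0 : R).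
  by move/cvgrPdist_lt => /(_ _ e0); apply: filterS => x; rewrite sub0r normrN;
     rewrite ger0_norm ?fine_prob_ge0.
apply/cvg_pinftyP => u uoo.
have Eu k : measurable (E (u k)) by exact: mE.
have foo : (V (\bigcup_(k >= 0) E (u k)) < +oo)%E.
  apply: le_lt_trans (ltry 1); apply: probability_le1.
  by apply: bigcup_measurable.
have := lim_sup_set_cvg V (fun k => E (u k)) Eu foo.
have -> : lim_sup_set (fun k => E (u k)) = set0.
  rewrite -subset0 => y Hy.
  have [X HX] := near_pinfty_ex (Ey y).
  move/cvgryPge : uoo => /(_ X) [N _ HN].
  have [k /= Nk Eky] := Hy N I.
  by apply: HX Eky; exact: HN.
rewrite measure0 => Vcvg.
have Vcvg' : V (E (u n)) @[n --> \oo] --> 0%E.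
  apply: (@squeeze_cvge _ _ _ _ (cst 0%E) _ _ _ _ _ Vcvg); last exact: cvg_cst.
  near=> n; rewrite measure_ge0/=; apply: le_measure; rewrite ?inE//.
    by apply: bigcup_measurable.
  by apply: bigcup_sup => /=.
by have /fine_cvg := Vcvg'.
Unshelve. all: by end_near. Qed.

End neighbourhoods_of_infinity.

(** * Distributions of a given local order *)

Section local_domination.
Context {R : realType} (T : R) (T_gt0 : 0 < T).
Implicit Types (V W G : distr R) (x y s t X : R).
Notation onR0 V := (V `]-oo, 0%R[%classic = 0%E).

(** The basic split of a convolution: if the first summand is at most [x - X], then
    the bound on [W] applies; if it lies in ]x - X, x + T], then the window of [W]
    has probability at most one; if it is larger, then that window lies on the
    negative half-line. *)
Lemma le_loc_conv V W G (C X x : R) : onR0 W -> 0 <= C ->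
  (forall u, X <= u -> loc T W u <= C * loc T G u) ->
  loc T (convolution V W) x <=
  C * loc T (convolution V G) x + fine (V `]x - X, x + T]%classic).
Proof.
move=> W0 C0 WG; have mI : measurable (`]x - X, x + T]%classic : set (measurableTypeR R)).
  exact: measurable_itv.
have bW := bmeas_loc T W x; have bG := bmeas_loc T G x.
have bI := @bmeas_indic _ _ R _ mI; have bCG := bmeasM (bmeas_cst C) bG.
rewrite !loc_conv -meanZ// -mean_indic// -meanD//.
apply: (le_mean V bW (bmeasD bCG bI)) => /=.
move=> y; have [yX|yX] := leP y (x - X).
  by rewrite (le_trans (WG _ _)) ?lerDl ?ler0n//; lra.
have [yT|yT] := leP y (x + T).
  rewrite indicE mem_set/=; last by rewrite in_itv/= yX yT.
  by rewrite (le_trans (loc_le1 _ _ _))// lerDr mulr_ge0// loc_ge0.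
rewrite (loc_eq0 W0); last lra.
by rewrite addr_ge0 ?ler0n// mulr_ge0// loc_ge0.
Qed.

Lemma le_window_sum V x n :
  fine (V `]x - n%:R * T, x + T]%classic) <= \sum_(i < n.+1) loc T V (x - i%:R * T).
Proof.
elim: n => [|n IH]; first by rewrite big_ord_recl big_ord0 addr0 mul0r subr0.
rewrite big_ord_recr/= (le_trans _ (lerD IH (lexx _)))//.
apply: le_trans (fine_prob_leU _ _ _); [|exact: measurable_itv..].
apply: fine_prob_le; [exact: measurable_itv| |].
  by apply: measurableU; exact: measurable_itv.
move=> z/=; rewrite !in_itv/= -natr1 => /andP[z1 z2].
have [zn|zn] := ltP (x - n%:R * T) z; [left|right]; rewrite ?z2 ?andbT//.
by apply/andP; split; lra.
Qed.

Definition loc_dom V G :=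
  exists C, 0 <= C /\ \forall x \near +oo, loc T V x <= C * loc T G x.

Lemma loc_dom_refl G : loc_dom G G.
Proof. by exists 1; split => //; apply: nearW => x; rewrite mul1r. Qed.

Lemma loc_dom_trans V W G : loc_dom V W -> loc_dom W G -> loc_dom V G.
Proof.
move=> [C [C0 VW]] [D [D0 WG]]; exists (C * D); split; first exact: mulr_ge0.
near=> x; rewrite -mulrA; apply: le_trans (_ : C * loc T W x <= _); first by near: x.
by apply: ler_wpM2l => //; near: x.
Unshelve. all: by end_near. Qed.

Lemma loc_dom_eq V V' G : (forall x, loc T V x = loc T V' x) -> loc_dom V G -> loc_dom V' G.
Proof.
by move=> E [C [C0 H]]; exists C; split => //; apply: filterS H => x; rewrite E.
Qed.

(** The properties of a local reference function that make domination by it stable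
    under convolution: shifts to the left and the convolution square cost at most
    a constant factor. Distributions in the classes L and OS have them, and so do the
    powers of the spectral distribution that are in OS alone. *)
Definition loc_regular G :=
  [/\ loc_pos T G,
      forall s, 0 <= s -> exists C, 0 <= C /\
        \forall x \near +oo, loc T G (x - s) <= C * loc T G x
    & loc_dom (convolution G G) G].

Lemma loc_dom_shift V G s : loc_regular G -> loc_dom V G -> 0 <= s ->
  exists C, 0 <= C /\ \forall x \near +oo, loc T V (x - s) <= C * loc T G x.
Proof.
move=> [_ Gs _] [C [C0 VG]] s0; have [D [D0 HD]] := Gs s s0.
exists (C * D); split; first exact: mulr_ge0.
have VG' := near_pinfty_shift (- s) VG.
near=> x; apply: le_trans (_ : C * loc T G (x - s) <= _); first by near: x.
by rewrite -mulrA; apply: ler_wpM2l => //; near: x.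
Unshelve. all: by end_near. Qed.

(** A bounded interval to the left of [x] is covered by finitely many shifted
    windows. *)
Lemma loc_dom_window V G X : loc_regular G -> loc_dom V G ->
  exists C, 0 <= C /\
    \forall x \near +oo, fine (V `]x - X, x + T]%classic) <= C * loc T G x.
Proof.
move=> rG dV; pose n := (Num.trunc (`|X| / T)).+1.
have nX : X <= n%:R * T.
  apply: le_trans (ler_norm X) _; rewrite -ler_pdivrMr//.
  exact/ltW/truncnS_gt.
have [C [C0 HC]] : exists C, 0 <= C /\ \forall x \near +oo,
    \sum_(i < n.+1) loc T V (x - i%:R * T) <= C * loc T G x.
  elim: n.+1 => [|m [C [C0 HC]]].
    by exists 0; split => //; apply: nearW => x; rewrite big_ord0 mul0r.
  have mT : 0 <= m%:R * T by rewrite mulr_ge0 ?ler0n// ltW.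
  have [D [D0 HD]] := loc_dom_shift rG dV mT.
  exists (C + D); split; first exact: addr_ge0.
  near=> x; rewrite big_ord_recr/= mulrDl; apply: lerD; near: x => //.
exists C; split => //; near=> x.
apply: le_trans (_ : fine (V `]x - n%:R * T, x + T]%classic) <= _).
  apply: fine_prob_le; [exact: measurable_itv..|] => z/=.
  by rewrite !in_itv/= => /andP[? ->]; rewrite andbT; lra.
apply: le_trans (le_window_sum _ _ _) _; near: x => //.
Unshelve. all: by end_near. Qed.

(** Each of [V] and [W] is replaced by [G] in turn, commutativity allowing to act on
    both factors; what remains is the convolution square of [G], and each
    replacement costs the probability of a window of bounded length. *)
Lemma loc_dom_conv V W G : loc_regular G -> onR0 V -> onR0 W ->
  loc_dom V G -> loc_dom W G -> loc_dom (convolution V W) G.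
Proof.
move=> rG V0 W0 dV dW.
have step V' W' : onR0 W' -> loc_dom W' G -> loc_dom V' G ->
    loc_dom (convolution V' G) G -> loc_dom (convolution V' W') G.
  move=> W'0 [C [C0 /near_pinfty_ex[X HX]]] dV' [D [D0 HD]].
  have [K [K0 HK]] := loc_dom_window X rG dV'.
  exists (C * D + K); split; first by rewrite addr_ge0// mulr_ge0.
  near=> x; apply: le_trans (le_loc_conv V' x W'0 C0 HX) _.
  rewrite mulrDl -mulrA; apply: lerD; last by near: x.
  by apply: ler_wpM2l => //; near: x.
have [_ _ dGG] := rG.
apply: (step V W) => //; apply: (loc_dom_eq (fun x => loc_convC T G V x)).
exact: (step G V) (loc_dom_refl G) dGG.
Unshelve. all: by end_near. Qed.

End local_domination.

(** * Quantified forms of the classes and of the liminf condition *)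

Section ratio_classes.
Context {R : realType} (T : R).
Implicit Types (V W G : distr R) (x y s t : R).

Lemma limf_esup_pinfty_lty (f : R -> R) :
  (limf_esup (fun x => (f x)%:E) +oo_R < +oo)%E <->
  exists C, 0 <= C /\ \forall x \near +oo, f x <= C.
Proof.
split=> [|[C [C0 HC]]]; last first.
  apply: le_lt_trans (ltry C); rewrite /limf_esup.
  apply: ge_ereal_inf; exists (ereal_sup ((fun x => (f x)%:E) @` [set x | f x <= C])).
    by exists [set x | f x <= C].
  by apply/ereal_supP => _ [x /= fx <-]; rewrite lee_fin.
move=> /ereal_inf_lt[_ [A FA <-]] supA.
have bA x : A x -> ((f x)%:E <= ereal_sup ((fun x => (f x)%:E) @` A))%E.
  by move=> Ax; apply: ereal_sup_ubound; exists x.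
case: (ereal_sup _) supA bA => [r _ bA|//|_ bA].
  exists `|r|; split => //; apply: filterS FA => x /bA; rewrite lee_fin => fr.
  exact: le_trans fr (ler_norm r).
by exists 0; split => //; apply: filterS FA => x /bA.
Qed.

Lemma limf_einf_pinfty_ge (f : R -> R) (l e : R) :
  (l%:E <= limf_einf (fun x => (f x)%:E) +oo_R)%E -> 0 < e ->
  \forall x \near +oo, l - e <= f x.
Proof.
rewrite /limf_einf leeNr => le_l e0.
have : (limf_esup (fun x => - (f x)%:E) +oo_R < (e - l)%:E)%E.
  by apply: le_lt_trans le_l _; rewrite -EFinN lte_fin; lra.
move=> /ereal_inf_lt[_ [A FA <-]] supA; apply: filterS FA => x Ax.
have : (- (f x)%:E < (e - l)%:E)%E.
  by apply: le_lt_trans supA; apply: ereal_sup_ubound; exists x.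
by rewrite -EFinN lte_fin; lra.
Qed.

Lemma class_OSE V : class_OS T V <-> loc_pos T V /\ loc_dom T (convolution V V) V.
Proof.
have E x : loc T (convolution_pow V 2) x = loc T (convolution V V) x.
  by rewrite /= !loc_conv; apply: eq_Rintegral => y _; rewrite loc_conv_dirac.
split=> -[pV HV]; split => //.
  have [C [C0 HC]] := (limf_esup_pinfty_lty _).1 HV.
  exists C; split => //; near=> x; rewrite -E -ler_pdivrMr; near: x => //.
have [C [C0 HC]] := HV; apply/limf_esup_pinfty_lty; exists C; split => //.
by near=> x; rewrite ler_pdivrMr ?E; near: x.
Unshelve. all: by end_near. Qed.

Lemma loc_liminf_ge1_decr V t e : loc_liminf_ge1 T V -> 0 <= t -> 0 < e ->
  \forall x \near +oo, (1 - e) * loc T V x <= loc T V (x - t).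
Proof.
move=> [pV HV]; rewrite le_eqVlt => /predU1P[<-|t0] e0.
  apply: nearW => x; rewrite subr0; have := loc_ge0 T V x; nra.
have H := limf_einf_pinfty_ge (HV t t0) e0.
by near=> x; rewrite -ler_pdivlMr; near: x.
Unshelve. all: by end_near. Qed.

Lemma class_LE V : class_L T V <-> loc_pos T V /\ forall t e, 0 < t -> 0 < e ->
  \forall x \near +oo, `|loc T V (x - t) - loc T V x| <= e * loc T V x.
Proof.
have E x t e : 0 < loc T V x ->
    (`|1 - loc T V (x - t) / loc T V x| <= e) =
    (`|loc T V (x - t) - loc T V x| <= e * loc T V x).
  move=> Vx; have -> : 1 - loc T V (x - t) / loc T V x =
      (loc T V x - loc T V (x - t)) / loc T V x by field; rewrite gt_eqF.
  by rewrite normrM normfV (ger0_norm (ltW Vx)) ler_pdivrMr// distrC.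
split=> -[pV HV]; split => // t.
  move=> e t0 e0; have /cvgrPdist_le/(_ _ e0) He := HV t t0.
  by near=> x; rewrite -E; near: x.
move=> t0; apply/cvgrPdist_le => e e0; have He := HV t e t0 e0.
by near=> x; rewrite E; near: x.
Unshelve. all: by end_near. Qed.

(** Shifts of both signs: a shift to the right is a shift to the left read from the
    other end. *)
Lemma class_L_shift V t e : class_L T V -> 0 < e ->
  \forall x \near +oo, `|loc T V (x + t) - loc T V x| <= e * loc T V x.
Proof.
move=> /class_LE[pV HV]; have [t0|t0|->] := ltgtP t 0 => e0.
- by rewrite -[t]opprK; apply: HV => //; lra.
- pose d := Num.min (1 / 2) (e / 2).
  have d0 : 0 < d by rewrite lt_min; apply/andP; split; lra.
  have d1 : d <= 1 / 2 by rewrite ge_min lexx.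
  have d2 : d <= e / 2 by rewrite ge_min lexx orbT.
  near=> x.
  have : `|loc T V (x + t - t) - loc T V (x + t)| <= d * loc T V (x + t).
    near: x; exact: (near_pinfty_shift t (HV t d t0 d0)).
  rewrite addrK distrC !ler_norml; have := loc_ge0 T V (x + t).
  move=> q0 /andP[? ?]; have p0 := loc_ge0 T V x.
  have dq : d * loc T V (x + t) <= 1 / 2 * loc T V (x + t) by exact: ler_wpM2r.
  have qp : loc T V (x + t) <= 2 * loc T V x by lra.
  have dp : d * loc T V (x + t) <= d * (2 * loc T V x) by rewrite ler_wpM2l// ltW.
  have ep : d * loc T V x <= e / 2 * loc T V x by exact: ler_wpM2r.
  by apply/andP; split; lra.
- by apply: nearW => x; rewrite addr0 subrr normr0 mulr_ge0 ?loc_ge0// ltW.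
Unshelve. all: by end_near. Qed.

Lemma class_LOS_regular V : class_LOS T V -> loc_regular T V.
Proof.
move=> [LV /class_OSE[pV dV]]; split => // s s0; exists 2; split => //.
near=> x; have : `|loc T V (x - s) - loc T V x| <= 1 * loc T V x.
  by near: x; apply: class_L_shift.
by rewrite ler_norml => /andP[]; lra.
Unshelve. all: by end_near. Qed.

End ratio_classes.

(** * A lower bound and a Kesten bound for convolutions *)

Section lower_bound_and_kesten.
Context {R : realType} (T : R) (T_gt0 : 0 < T).
Implicit Types (V W G : distr R) (x y s t X : R).
Notation onR0 V := (V `]-oo, 0%R[%classic = 0%E).

(** Adding an independent variable that is at least [s] cannot lower the local
    probabilities much below those of the shift by [s], since the liminf condition
    says that those of [W] do not increase asymptotically. The factor 4 comes
    from losing one half twice: in the liminf bound itself, and to the shifts at which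
    it has not set in yet. With [s = 0] this compares [W] with [G * W]; with
    [s = 1] and [G = W] it turns the class OS into a bound for shifts. *)
Lemma loc_conv_lower G W s : G `]-oo, s[%classic = 0%E -> loc_liminf_ge1 T W ->
  \forall x \near +oo, loc T W (x - s) <= 4 * loc T (convolution G W) x.
Proof.
move=> Gs LW; have half0 : (0 < 1 / 2 :> R) by lra.
(* The shifts at which the liminf bound fails at x. *)
pose E x : set (measurableTypeR R) := `[s, +oo[%classic `&`
  (fun y : measurableTypeR R => loc T W (x - y)) @^-1` `]-oo, 1 / 2 * loc T W (x - s)[%classic.
have mE x : measurable (E x).
  apply: measurableI; first exact: measurable_itv.
  rewrite -[X in measurable X]setTI; have [mf _] := bmeas_loc T W x.
  by apply: mf => //; exact: measurable_itv.
have nE y : \forall x \near +oo, ~ E x y.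
  have [sy|ys] := leP s y; last first.
    by apply: nearW => x [/=]; rewrite in_itv/= andbT leNgt ys.
  have ys0 : 0 <= y - s by rewrite subr_ge0.
  have := near_pinfty_shift (- s) (loc_liminf_ge1_decr LW ys0 half0).
  apply: filterS => x; rewrite (_ : x - s - (y - s) = x - y); last by ring.
  by move=> H [_ /=]; rewrite in_itv/=; lra.
have := prob_near_lt G mE nE half0; apply: filterS => x GE.
set w := loc T W (x - s) in E mE nE GE *; have w0 : 0 <= w by exact: loc_ge0.
have bE := @bmeas_indic _ _ R _ (mE x); have bwE := bmeasM (bmeas_cst (1 / 2 * w)) bE.
have bW := bmeas_loc T W x.
have := le_mean_halfline Gs (@bmeas_cst _ (measurableTypeR R) R (1 / 2 * w)) (bmeasD bW bwE).
rewrite mean_cst meanD// meanZ// mean_indic// -loc_conv => H.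
have {}H : 1 / 2 * w <= loc T (convolution G W) x + 1 / 2 * w * fine (G (E x)).
  apply: H => y sy; have [Ey|nEy] := pselect (E x y).
    by rewrite indicE mem_set// mulr1 lerDr loc_ge0.
  rewrite indicE memNset// mulr0 addr0 leNgt; apply/negP => lt_w; apply: nEy.
  by split; rewrite /= in_itv/= ?sy.
have : 1 / 2 * w * fine (G (E x)) <= 1 / 2 * w * (1 / 2).
  by rewrite ler_wpM2l ?(ltW GE)// mulr_ge0// ltW.
lra.
Qed.

(** On compact sets far out the local reference function stays away from zero. The
    window at [z - t] is covered by those at [z - T] and [z], which bounds all shifts
    by at most [T] uniformly, without the uniform convergence theorem for slowly
    varying functions. *)
Lemma loc_bounded_below G : loc_regular T G -> exists X0, forall X n, X0 <= X ->
  exists2 c, 0 < c & forall x, X <= x <= X + n%:R * T -> c <= loc T G x.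
Proof.
move=> [pG Gs _]; have [C [C0 HC]] := Gs T (ltW T_gt0).
have [X0 HX0] : exists X0, forall x, X0 <= x ->
    0 < loc T G x /\ loc T G (x - T) <= C * loc T G x.
  by apply: near_pinfty_ex; near=> x; split; near: x.
have step z t : X0 <= z -> 0 <= t <= T -> loc T G (z - t) <= (C + 1) * loc T G z.
  move=> /HX0[_ zT] /andP[t0 tT]; rewrite mulrDl mul1r.
  apply: le_trans (lerD zT (lexx _)).
  apply: le_trans (fine_prob_leU _ _ _); [|exact: measurable_itv..].
  apply: fine_prob_le; [exact: measurable_itv| |].
    by apply: measurableU; exact: measurable_itv.
  move=> u/=; rewrite !in_itv/= => /andP[u1 u2].
  by have [uz|uz] := leP u z; [left|right]; apply/andP; split; lra.
exists X0 => X n XX; elim: n => [|n [c c0 Hc]].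
  exists (loc T G X); first by have [] := HX0 _ XX.
  by move=> x; rewrite mul0r addr0 => Xx; rewrite (_ : x = X)//; lra.
have nT : 0 <= n%:R * T by rewrite mulr_ge0 ?ler0n// ltW.
exists (c / (C + 1)) => [|x /andP[Xx xn]]; first by apply: divr_gt0 => //; lra.
rewrite ler_pdivrMr; last lra.
have [xX|xX] := leP x (X + n%:R * T).
  have := Hc x; rewrite Xx xX => /(_ isT) cx; have := loc_ge0 T G x; nra.
have cX : c <= loc T G (X + n%:R * T) by apply: Hc; apply/andP; split; lra.
rewrite mulrC (le_trans cX)//.
have -> : X + n%:R * T = x - (x - (X + n%:R * T)) by ring.
apply: step; first lra.
by move: xn; rewrite -natr1 mulrDl mul1r => xn; apply/andP; split; lra.
Unshelve. all: by end_near. Qed.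

(** One threshold [X] serves all powers, which is what allows summing the bound over
    [k]. The recursion is the basic split of a convolution; its remainder does not
    depend on [k], and for the [x] between [X] and the point where the
    asymptotic bound of the remainder starts, the lower bound of [G] on compact sets
    replaces it. *)
Lemma loc_kesten V G : loc_regular T G -> onR0 V -> onR0 G -> loc_dom T V G ->
  exists X C B, [/\ 0 <= C, 0 <= B & forall k x, X <= x ->
    loc T (convolution_pow V k) x <= C * B ^+ k * loc T G x].
Proof.
move=> rG V0 G0 dV.
have [M [M0 /near_pinfty_ex[X1 HM]]] :=
  loc_dom_conv T_gt0 rG V0 G0 dV (loc_dom_refl T G).
have [X0 HX0] := loc_bounded_below rG.
pose X := Num.max 0 (Num.max X0 X1).
have X_ge0 : 0 <= X by rewrite le_max lexx.
have X_geX0 : X0 <= X by rewrite !le_max lexx orbT.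
have X_geX1 : X1 <= X by rewrite !le_max lexx !orbT.
have [K [K0 /near_pinfty_ex[X2 HK]]] := loc_dom_window T_gt0 X rG dV.
pose n := (Num.trunc (`|X2| / T)).+1.
have nX2 : X2 <= X + n%:R * T.
  have : `|X2| < n%:R * T by rewrite -ltr_pdivrMr// truncnS_gt.
  by have := ler_norm X2; lra.
have [c c0 Hc] := HX0 X n X_geX0.
have ci0 : 0 < c^-1 by rewrite invr_gt0.
have win x : X <= x -> fine (V `]x - X, x + T]%classic) <= (K + c^-1) * loc T G x.
  move=> Xx; have [xX2|X2x] := leP x (X + n%:R * T).
    apply: (@le_trans _ _ 1); first by apply: fine_prob_le1; exact: measurable_itv.
    have cx := Hc x _; rewrite Xx xX2 in cx; have {}cx := cx isT.
    rewrite mulrDl ler_wpDl ?mulr_ge0 ?loc_ge0// mulrC ler_pdivlMr// mul1r//.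
  rewrite mulrDl ler_wpDr ?mulr_ge0 ?loc_ge0 ?(ltW ci0)//; apply: HK; lra.
exists X, (K + c^-1), (M + 1); split; [lra|lra|].
have B1 k : 1 <= (M + 1) ^+ k by rewrite exprn_ege1//; lra.
elim=> [|k IH] x Xx.
  rewrite loc_dirac; last exact: le_trans Xx.
  by rewrite expr0 mulr1; apply: mulr_ge0; [lra|exact: loc_ge0].
have V0k : onR0 (convolution_pow V k).
  by case: k {IH} => [|k]; [exact: dirac_null|exact: convolution_pow_null].
have Ck0 : 0 <= (K + c^-1) * (M + 1) ^+ k.
  by have := B1 k; move=> ?; apply: mulr_ge0; lra.
apply: le_trans (le_loc_conv V x V0k Ck0 IH) _.
have g0 := loc_ge0 T G x.
apply: le_trans (lerD (ler_wpM2l Ck0 (HM x (le_trans X_geX1 Xx))) (win x Xx)) _.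
have : (K + c^-1) * loc T G x <= (K + c^-1) * (M + 1) ^+ k * loc T G x.
  apply: ler_wpM2r => //; rewrite ler_peMr//; lra.
by rewrite exprSr; lra.
Qed.

End lower_bound_and_kesten.

(** * The Poisson series *)

Section compound_poisson_series.
Context {R : realType} (m : {nonneg R}).
Implicit Types (V : distr R) (A : set (measurableTypeR R)).

Definition poisson_weight (k : nat) : R := expR (- m%:num) * (m%:num ^+ k / k`!%:R).

Lemma poisson_weight_ge0 k : 0 <= poisson_weight k.
Proof. by rewrite mulr_ge0 ?expR_ge0// divr_ge0 ?exprn_ge0 ?ler0n. Qed.

Lemma poisson_weight_gt0 k : 0 < m%:num -> 0 < poisson_weight k.
Proof. by move=> m0; rewrite mulr_gt0 ?expR_gt0// divr_gt0 ?exprn_gt0 ?ltr0n ?fact_gt0. Qed.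

Lemma compound_poisson_cvg V A : measurable A ->
  \sum_(k < n) (poisson_weight k * fine (convolution_pow V k A)) @[n --> \oo] -->
  fine (compound_poisson m V A).
Proof.
move=> mA; suff : (\sum_(k < n) (poisson_weight k * fine (convolution_pow V k A)))%:E
    @[n --> \oo] --> (fine (compound_poisson m V A))%:E by move/fine_cvg.
rewrite EFin_prob//.
pose u n := (\sum_(0 <= k < n) (m%:num ^+ k / k`!%:R)%:E * convolution_pow V k A)%E.
have ucvg : ((expR (- m%:num))%:E * u n)%E @[n --> \oo] --> compound_poisson m V A.
  have wge0 k : (0 <= k)%N -> xpredT k ->
      (0 <= (m%:num ^+ k / k`!%:R)%:E * convolution_pow V k A)%E.
    by move=> _ _; rewrite mule_ge0 ?measure_ge0// lee_fin divr_ge0 ?exprn_ge0 ?ler0n.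
  by have := @cvgeZl _ _ _ _ _ (expR (- m%:num))%:E isT (is_cvg_nneseries wge0).
apply: cvg_trans ucvg; apply: near_eq_cvg; apply: nearW => n /=.
rewrite /u big_mkord -sumEFin ge0_sume_distrr; last first.
  by move=> k _; rewrite mule_ge0 ?measure_ge0// lee_fin divr_ge0 ?exprn_ge0 ?ler0n.
apply: eq_bigr => k _.
by rewrite /poisson_weight !EFinM EFin_prob// muleA.
Qed.

Lemma le_compound_poisson V A n : measurable A ->
  \sum_(k < n) (poisson_weight k * fine (convolution_pow V k A)) <=
  fine (compound_poisson m V A).
Proof.
move=> mA; have c := @compound_poisson_cvg V _ mA; rewrite -(cvg_lim _ c)//.
apply: nondecreasing_cvgn_le; last by apply/cvg_ex; eexists; exact: c.
apply/nondecreasing_seqP => k; rewrite big_ord_recr/= lerDl mulr_ge0//.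
  exact: poisson_weight_ge0.
exact: fine_prob_ge0.
Qed.

(** The weights decay factorially while the powers grow at most geometrically, so the
    tail of the series is a small multiple of [g], uniformly in the set [A]. *)
Lemma compound_poisson_tail V (C B e : R) : 0 <= C -> 0 <= B -> 0 < e ->
  exists N, forall n A g, (N <= n)%N -> measurable A -> 0 <= g ->
    (forall k, fine (convolution_pow V k A) <= C * B ^+ k * g) ->
    fine (compound_poisson m V A) <=
    \sum_(k < n) (poisson_weight k * fine (convolution_pow V k A)) + e * g.
Proof.
move=> C0 B0 e0; pose K := C * expR (- m%:num); have K0 : 0 <= K by rewrite mulr_ge0 ?expR_ge0.
have sB : 0 <= m%:num * B by exact: mulr_ge0.
pose s n := series (exp_coeff (m%:num * B)) n.
have scvg : s n @[n --> \oo] --> expR (m%:num * B) by exact: is_cvg_series_exp_coeff.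
have s_nd : nondecreasing_seq s.
  by apply: nondecreasing_series => k _ _; exact: exp_coeff_ge0.
have sle n : s n <= expR (m%:num * B).
  by rewrite -(cvg_lim _ scvg)//; exact: nondecreasing_cvgn_le.
have eK : 0 < e / (K + 1) by rewrite divr_gt0//; lra.
have /cvgrPdist_le/(_ _ eK)[N _ HN] := scvg.
exists N => n A g Nn mA g0 HV.
have tail M : (n <= M)%N -> \sum_(k < M) (poisson_weight k * fine (convolution_pow V k A)) <=
    \sum_(k < n) (poisson_weight k * fine (convolution_pow V k A)) + e * g.
  move=> nM; rewrite -!(big_mkord xpredT
    (fun k => poisson_weight k * fine (convolution_pow V k A))).
  rewrite (big_cat_nat (leq0n n) nM)//= lerD2l.
  apply: (@le_trans _ _ (K * (s M - s n) * g)); last first.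
    apply: ler_wpM2r => //.
    have : expR (m%:num * B) - s n <= e / (K + 1) by apply: le_trans (ler_norm _) (HN _ Nn).
    have := sle M; move=> sM snN; apply: (@le_trans _ _ (K * (e / (K + 1)))).
      by apply: ler_wpM2l => //; lra.
    by rewrite mulrA ler_pdivrMr; nra.
  rewrite /s /series/= (big_cat_nat (leq0n n) nM)//= addrAC subrr add0r mulr_sumr mulr_suml.
  apply: ler_sum => k _; apply: le_trans (ler_wpM2l (poisson_weight_ge0 k) (HV k)) _.
  rewrite /poisson_weight /K /exp_coeff/= exprMn le_eqVlt; apply/orP; left; apply/eqP; ring.
have c := @compound_poisson_cvg V _ mA; rewrite -(cvg_lim _ c)//.
apply: limr_le; first by apply/cvg_ex; eexists; exact: c.
by exists n.
Qed.

End compound_poisson_series.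

(** * The spectral distribution and the Landau symbols *)

Section levy_facts.
Context {R : realType} (nu : {measure set (measurableTypeR R) -> \bar R}) (a : R).
Context (hdata : levy_data a nu).

Lemma levy_mass_gt0 : 0 < (levy_mass nu)%:num.
Proof. by have [_ _ /= /fine_gt0] := hdata. Qed.

Lemma levy_spectral_null : levy_spectral nu `]-oo, 1%R[%classic = 0%E.
Proof.
have [_ _ /andP[n0 noo] _] := hdata.
have n1 : mrestr nu (measurable_itv `]1%R, +oo[) setT = nu `]1%R, +oo[%classic.
  by rewrite /mrestr setTI.
have m0 : mrestr nu (measurable_itv `]1%R, +oo[) `]-oo, 1%R[%classic = 0%E.
  rewrite /mrestr (_ : _ `&` _ = set0) ?measure0//.
  by apply/seteqP; split => z//=; rewrite !in_itv/= andbT; lra.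
change (mnormalize (mrestr nu (measurable_itv `]1%R, +oo[))
  (\d_(0 : measurableTypeR R)) `]-oo, 1%R[%classic = 0%E).
rewrite /mnormalize; case: ifPn => [/orP[/eqP h|/eqP h]|_].
- by move: n0; rewrite (etrans (esym n1) h) ltxx.
- by move: noo; rewrite (etrans (esym n1) h) ltxx.
exact: etrans (congr1 (fun z => z * _)%E m0) (mul0e _).
Qed.

End levy_facts.

Section landau_facts.
Context {R : realType} (T : R).
Implicit Types (V W : distr R).

Lemma loc_dom_eqO V W : loc_dom T V W -> loc T V =O_ (pinfty_nbhs R) loc T W.
Proof.
move=> [C [C0 VW]]; apply/eqO_exP; exists (C + 1); first lra.
near=> x; rewrite !ger0_norm ?loc_ge0//.
apply: (@le_trans _ _ (C * loc T W x)); first by near: x.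
by rewrite ler_wpM2r ?loc_ge0//; lra.
Unshelve. all: by end_near. Qed.

Lemma loc_eqo_le V W e : loc T V =o_ (pinfty_nbhs R) loc T W -> 0 < e ->
  \forall x \near +oo, loc T V x <= e * loc T W x.
Proof.
move=> /eqoP/(_ _ _) H e0; have := H e e0.
by apply: filterS => x; rewrite !ger0_norm ?loc_ge0.
Qed.

End landau_facts.

(** * The compound Poisson factor of an infinitely divisible distribution *)

Section shift_gain.
Context {R : realType} (T : R).

(** A drop of [W] by at least [D] over the whole block of shifts in [0, A], outside an
    exceptional set [B], is inherited by the convolution up to the mass of [B] and
    of ]A, +oo[. The inequality is integrated pointwise; on [B] the window of [W] is
    estimated by an interval that contains all of them. *)
Lemma loc_conv_gain (V W : distr R) (B : set (measurableTypeR R)) (A t x D : R) :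
  V `]-oo, 0%R[%classic = 0%E -> measurable B -> B `<=` `[0, A]%classic -> 0 <= D ->
  (forall y, 0 <= y <= A -> ~ B y -> loc T W (x + A - y) + D <= loc T W (x - t - y)) ->
  loc T (convolution V W) (x + A) + D <= loc T (convolution V W) (x - t) +
    (fine (W `]x + A - A, x + A + T]%classic) + D) * fine (V B) +
    \int[V]_y (\1_`]A, +oo[%classic y * loc T W (x + A - y)) +
    D * fine (V `]A, +oo[%classic).
Proof.
move=> V0 mB BA D0 gain; set P := fine (W _).
have bA := bmeas_loc T W (x + A); have bt := bmeas_loc T W (x - t).
have mI : measurable (`]A, +oo[%classic : set (measurableTypeR R)) by exact: measurable_itv.
have bI := @bmeas_indic _ _ R _ mI; have bB := @bmeas_indic _ _ R _ mB.
have bL := bmeasD bA (@bmeas_cst _ (measurableTypeR R) R D).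
have bQB := bmeasM (@bmeas_cst _ (measurableTypeR R) R (P + D)) bB.
have bI2 := bmeasM bI bA.
have bDI := bmeasM (@bmeas_cst _ (measurableTypeR R) R D) bI.
have bR1 := bmeasD bt bQB; have bR2 := bmeasD bR1 bI2; have bR := bmeasD bR2 bDI.
have := le_mean_halfline V0 bL bR.
rewrite (meanD V bR2 bDI) (meanD V bR1 bI2) (meanD V bt bQB) (meanD V bA) ?mean_cst;
  last exact: bmeas_cst.
rewrite (meanZ V _ bB) (meanZ V _ bI) !mean_indic// -!loc_conv; apply => y y0.
have hy := loc_ge0 T W (x - t - y); have hAy := loc_ge0 T W (x + A - y).
have [By|nBy] := pselect (B y).
  have yA : y <= A by have := BA _ By; rewrite /= in_itv/= => /andP[].
  have Py : loc T W (x + A - y) <= P.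
    apply: fine_prob_le; [exact: measurable_itv..|] => z/=.
    by rewrite !in_itv/= => /andP[? ?]; apply/andP; split; lra.
  have i0 : 0 <= \1_`]A, +oo[%classic y :> R by rewrite indicE ler0n.
  rewrite (indicE _ B) mem_set// mulr1.
  by have := mulr_ge0 i0 hAy; have := mulr_ge0 D0 i0; lra.
rewrite (indicE _ B) memNset// mulr0 addr0.
have [Ay|yA] := ltP A y.
  by rewrite indicE mem_set/= ?in_itv/= ?Ay// mul1r mulr1; lra.
rewrite indicE memNset/= ?in_itv/= ?andbT; last by apply/negP; rewrite -leNgt.
by rewrite mul0r mulr0 !addr0; apply: gain => //; rewrite y0.
Qed.

End shift_gain.

Section poisson_mixture.
Context {R : realType} (T : R) (T_gt0 : 0 < T) (F H H1 : distr R) (m : {nonneg R}).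
Notation onR0 V := (V `]-oo, 0%R[%classic = 0%E).
Notation Fk k := (convolution_pow F k).
Notation p k := (poisson_weight m k).
Let H2 : distr R := compound_poisson m F.
Context (m_gt0 : 0 < m%:num) (F_null : F `]-oo, 1%R[%classic = 0%E)
  (H_null : onR0 H) (H1_null : onR0 H1)
  (HE : forall x, loc T H x = loc T (convolution H1 H2) x)
  (hF : forall k, (1 <= k)%N -> loc_liminf_ge1 T (Fk k))
  (H12 : forall e, 0 < e -> \forall x \near +oo, loc T H1 x <= e * loc T H2 x)
  (LOS_H : class_LOS T H).

Let regH : loc_regular T H := class_LOS_regular LOS_H.

Lemma null_le (V : distr R) (s t : R) : s <= t -> V `]-oo, t[%classic = 0%E ->
  V `]-oo, s[%classic = 0%E.
Proof.
move=> st V0; apply/eqP; rewrite eq_le measure_ge0 andbT -V0.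
apply: le_measure; rewrite ?inE; [exact: measurable_itv..|].
by move=> z/=; rewrite !in_itv/= => /lt_le_trans; apply.
Qed.

Let F0 : onR0 F := null_le ler01 F_null.

Let Fk0 k : onR0 (Fk k).
Proof. by case: k => [|k]; [exact: dirac_null|exact: convolution_pow_null]. Qed.

Lemma loc_Fk1 x : loc T (Fk 1) x = loc T F x.
Proof. exact: loc_conv_dirac. Qed.

(** A compound Poisson variable has exactly one jump with positive probability, so
    [H] dominates a multiple of [H1 * F], and convolving [F] with [H1] loses at most
    a constant factor. *)
Lemma loc_dom_F : loc_dom T F H.
Proof.
apply: (loc_dom_eq loc_Fk1).
have p1 : 0 < p 1 := poisson_weight_gt0 1 m_gt0.
have mix u : p 1 * loc T (Fk 1) u <= loc T H2 u.
  have := @le_compound_poisson _ m F `]u, u + T]%classic 2 (measurable_itv _).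
  rewrite !big_ord_recl big_ord0 addr0; apply: le_trans; rewrite lerDr.
  by rewrite mulr_ge0 ?poisson_weight_ge0 ?fine_prob_ge0.
have mixH x : p 1 * loc T (convolution H1 (Fk 1)) x <= loc T H x.
  rewrite HE !loc_conv -meanZ; last exact: bmeas_loc.
  have bF := bmeas_loc T (Fk 1) x; have b2 := bmeas_loc T H2 x.
  exact: (le_mean H1 (bmeasM (bmeas_cst (p 1)) bF) b2) => y; exact: mix.
have low := loc_conv_lower H1_null (hF (leqnn 1)).
exists (4 / p 1); split; first by rewrite divr_ge0// ltW.
near=> x; have xlow : loc T (Fk 1) (x - 0) <= 4 * loc T (convolution H1 (Fk 1)) x.
  by near: x.
rewrite subr0 in xlow; apply: le_trans xlow _.
rewrite -mulrA; apply: ler_wpM2l => //.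
by rewrite mulrC ler_pdivlMr// mulrC.
Unshelve. all: by end_near. Qed.

Lemma kesten_F : exists X C B, [/\ 0 <= C, 0 <= B & forall k x, X <= x ->
  loc T (Fk k) x <= C * B ^+ k * loc T H x].
Proof. exact (loc_kesten T_gt0 regH F0 H_null loc_dom_F). Qed.

Lemma loc_dom_Fk k : loc_dom T (Fk k) H.
Proof.
have [X [C [B [C0 B0 HX]]]] := kesten_F; exists (C * B ^+ k).
split; first by rewrite mulr_ge0// exprn_ge0.
by near=> x; apply: HX; near: x; apply: nbhs_pinfty_ge; rewrite num_real.
Unshelve. all: by end_near. Qed.

Lemma loc_H2_tail e : 0 < e -> exists N, forall n, (N <= n)%N ->
  \forall x \near +oo, loc T H2 x <= \sum_(k < n) p k * loc T (Fk k) x + e * loc T H x.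
Proof.
have [X [C [B [C0 B0 HX]]]] := kesten_F => e0.
have [N HN] := compound_poisson_tail m F C0 B0 e0; exists N => n Nn.
near=> x; have Xx : X <= x by near: x; apply: nbhs_pinfty_ge; rewrite num_real.
exact: (HN n `]x, x + T]%classic (loc T H x) Nn (measurable_itv _) (loc_ge0 _ _ _)
  (fun k => HX k x Xx)).
Unshelve. all: by end_near. Qed.

Lemma loc_H2_ge n x : \sum_(k < n) p k * loc T (Fk k) x <= loc T H2 x.
Proof. by apply: le_compound_poisson; exact: measurable_itv. Qed.

Lemma sum_weight_le1 n : \sum_(k < n) p k <= 1.
Proof.
have := @le_compound_poisson _ m F setT n measurableT.
rewrite [X in fine X](probability_setT (compound_poisson m F)); apply: le_trans.
apply: ler_sum => k _.
by rewrite [X in fine X](probability_setT (Fk k)) mulr1.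
Qed.

Lemma loc_dom_H2 : loc_dom T H2 H.
Proof.
have [N HN] := loc_H2_tail ltr01; have {}HN := HN N (leqnn N).
have [C [C0 HC]] : exists C, 0 <= C /\ \forall x \near +oo,
    \sum_(k < N) p k * loc T (Fk k) x <= C * loc T H x.
  elim: (N) => [|n [C [C0 HC]]].
    by exists 0; split => //; apply: nearW => x; rewrite big_ord0 mul0r.
  have [D [D0 HD]] := loc_dom_Fk n; exists (C + p n * D).
  split; first by rewrite addr_ge0// mulr_ge0// poisson_weight_ge0.
  near=> x; rewrite big_ord_recr/= mulrDl; apply: lerD; first by near: x.
  rewrite -[p n * D * _]mulrA; apply: ler_wpM2l; first exact: poisson_weight_ge0.
  by near: x.
exists (C + 1); split; first lra.
near=> x; apply: le_trans (_ : _ <= \sum_(k < N) p k * loc T (Fk k) x + 1 * loc T H x) _.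
  by near: x.
by rewrite mulrDl lerD2r; near: x.
Unshelve. all: by end_near. Qed.

(** The local probabilities of [V] do not increase, up to an error that is small
    compared with those of [H]. Measuring the error by [H] rather than by [V] makes
    the property additive, hence inherited by the Poisson series. *)
Definition loc_decr V := forall t e, 0 <= t -> 0 < e ->
  \forall x \near +oo, loc T V x <= loc T V (x - t) + e * loc T H x.

Lemma loc_decr_Fk k : loc_decr (Fk k).
Proof.
move=> t e t0 e0; case: k => [|k].
  near=> x; rewrite loc_dirac; last by near: x; apply: nbhs_pinfty_ge; rewrite num_real.
  by rewrite addr_ge0 ?mulr_ge0 ?loc_ge0// ltW.
have [C [C0 HC]] := loc_dom_Fk k.+1.
have eC : 0 < e / (C + 1) by rewrite divr_gt0//; lra.
have low := loc_liminf_ge1_decr (hF (ltn0Sn k)) t0 eC.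
near=> x.
have xl : (1 - e / (C + 1)) * loc T (Fk k.+1) x <= loc T (Fk k.+1) (x - t) by near: x.
have xC : loc T (Fk k.+1) x <= C * loc T H x by near: x.
have : e / (C + 1) * loc T (Fk k.+1) x <= e * loc T H x.
  have h0 := loc_ge0 T H x.
  apply: le_trans (ler_wpM2l (ltW eC) xC) _.
  rewrite mulrAC ler_pdivrMr; last lra.
  rewrite -mulrA ler_wpM2l ?(ltW e0)//; lra.
by lra.
Unshelve. all: by end_near. Qed.

Lemma loc_decr_H2 : loc_decr H2.
Proof.
move=> t e t0 e0; have e2 : 0 < e / 2 by lra.
have [N HN] := loc_H2_tail e2; have {}HN := HN N (leqnn N).
have all_k : \forall x \near +oo, forall k : 'I_N,
    loc T (Fk k) x <= loc T (Fk k) (x - t) + e / 2 * loc T H x.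
  by apply: filter_forall => k; exact: loc_decr_Fk.
near=> x; have h0 := loc_ge0 T H x.
have xN : loc T H2 x <= \sum_(k < N) p k * loc T (Fk k) x + e / 2 * loc T H x.
  by near: x.
have xall (k : 'I_N) : loc T (Fk k) x <= loc T (Fk k) (x - t) + e / 2 * loc T H x.
  by move: k; near: x.
have xk : \sum_(k < N) p k * loc T (Fk k) x <=
    \sum_(k < N) p k * loc T (Fk k) (x - t) + (\sum_(k < N) p k) * (e / 2 * loc T H x).
  rewrite mulr_suml -big_split/=; apply: ler_sum => k _; rewrite -mulrDr.
  by apply: ler_wpM2l; [exact: poisson_weight_ge0|exact: xall].
have w1 : (\sum_(k < N) p k) * (e / 2 * loc T H x) <= 1 * (e / 2 * loc T H x).
  by apply: ler_wpM2r (sum_weight_le1 N); rewrite mulr_ge0// ltW.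
have := loc_H2_ge N (x - t); lra.
Unshelve. all: by end_near. Qed.

Let H2_null : onR0 H2.
Proof.
have := @compound_poisson_cvg _ m F `]-oo, 0%R[%classic (measurable_itv _).
rewrite (_ : (fun n => _) = cst 0); last first.
  by apply/funext => n; rewrite big1// => k _; rewrite Fk0 mulr0.
move=> /(cvg_unique (@Rhausdorff R))/(_ (cvg_cst _)) c0.
by rewrite -EFin_prob ?c0//; exact: measurable_itv.
Qed.

Lemma loc_dom_H2H2 : loc_dom T (convolution H2 H2) H.
Proof. exact: (loc_dom_conv T_gt0 regH H2_null H2_null loc_dom_H2 loc_dom_H2). Qed.

(** If the first summand exceeds [A], then the second one is below [x + T - A].
    Integrating over the second summand, the first then lies in a window that is far
    out, where [H1] is negligible against [H2]; this leaves a small multiple of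
    the convolution square of [H2]. *)
Lemma H1_tail e : 0 < e -> exists A0, forall A, A0 <= A -> \forall x \near +oo,
  \int[H1]_y (\1_`]A, +oo[%classic y * loc T H2 (x - y)) <= e * loc T H x.
Proof.
move=> e0; have [K [K0 HK]] := loc_dom_H2H2.
have eK : 0 < e / (K + 1) by rewrite divr_gt0//; lra.
have [X HX] := near_pinfty_ex (H12 eK).
exists (X + T) => A XA; near=> x.
pose E : set (measurableTypeR R * measurableTypeR R) :=
  fst @^-1` `]A, +oo[%classic `&` (@sumR R) @^-1` `]x, x + T]%classic.
have mE : measurable E.
  apply: measurableI.
    rewrite -[X in measurable X]setTI.
    by apply: measurable_fst => //; exact: measurable_itv.
  by apply: measurable_sum_preimage; exact: measurable_itv.
have -> : (\int[H1]_y (\1_`]A, +oo[%classic y * loc T H2 (x - y)) =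
    \int[H1]_y fine (H2 (xsection E y)))%R.
  apply: eq_Rintegral => y _; rewrite indicE /loc -(shift_window T x y).
  have [Ay|yA] := ltP A y.
    rewrite mem_set/= ?in_itv/= ?Ay// mul1r; congr (fine (H2 _)).
    by apply/seteqP; split => z; rewrite /xsection/= inE /E/= ?in_itv/= ?Ay// => -[].
  rewrite memNset/= ?in_itv/= ?andbT; last by apply/negP; rewrite -leNgt.
  rewrite mul0r (_ : xsection _ _ = set0) ?measure0//.
  apply/seteqP; split => z //; rewrite /xsection/= inE /E/= in_itv/= andbT => -[].
  by rewrite ltNge yA.
rewrite mean_sections//.
have bE := bmeas_ysection H1 mE; have b2 := bmeas_loc T H2 x.
apply: (@le_trans _ _ (e / (K + 1) * loc T (convolution H2 H2) x)).
  rewrite loc_conv -meanZ//; apply: (le_mean H2 bE (bmeasM (bmeas_cst _) b2)) => z.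
  have r0 : 0 <= e / (K + 1) * loc T H2 (x - z) by rewrite mulr_ge0 ?loc_ge0// ltW.
  have [xz|xz] := leP (x - z + T) A.
    rewrite (_ : ysection _ _ = set0) ?measure0//.
    by apply/seteqP; split => y //; rewrite /ysection/= inE /E/= !in_itv/= andbT;
      move=> [? /andP[]]; rewrite /sumR/=; lra.
  apply: (@le_trans _ _ (loc T H1 (x - z))); last by apply: HX; lra.
  apply: fine_prob_le; [exact: measurable_ysection|exact: measurable_itv|].
  move=> y; rewrite /ysection/= inE /E/= !in_itv/= andbT /sumR/= => -[_ /andP[? ?]].
  by apply/andP; split; lra.
have xK : loc T (convolution H2 H2) x <= K * loc T H x by near: x.
apply: le_trans (ler_wpM2l (ltW eK) xK) _.
have h0 := loc_ge0 T H x.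
rewrite mulrAC ler_pdivrMr; last lra.
by rewrite -mulrA ler_wpM2l ?(ltW e0)//; lra.
Unshelve. all: by end_near. Qed.

(** By the tail estimate, at least half of the local mass of [H] comes from values of the first
    summand in [0, A], hence from finitely many windows of [H2] to the left of [x].
    Since [H] is insensitive to shifts, the estimate may be read at [x + n T], where
    these windows lie to the right of [x]; there almost-monotonicity brings them
    back to [x]. *)
Lemma loc_dom_H : loc_dom T H H2.
Proof.
have half0 : (0 < 1 / 2 :> R) by lra.
have [A0 HA0] := H1_tail half0; pose A := Num.max A0 0.
have AA0 : A0 <= A by rewrite le_max lexx.
pose n := (Num.trunc (`|A| / T)).+1.
have nA : A <= n%:R * T.
  have : `|A| < n%:R * T by rewrite -ltr_pdivrMr// truncnS_gt.
  by have := ler_norm A; lra.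
have n0 : 0 <= n%:R * T by rewrite mulr_ge0 ?ler0n// ltW.
have upper : \forall x \near +oo, loc T H x <= 2 * \sum_(i < n.+1) loc T H2 (x - i%:R * T).
  near=> x; have xA : \int[H1]_y (\1_`]A, +oo[%classic y * loc T H2 (x - y)) <=
    1 / 2 * loc T H x by near: x; exact: HA0.
  have b2 := bmeas_loc T H2 x.
  have mA : measurable (`]A, +oo[%classic : set (measurableTypeR R)) by exact: measurable_itv.
  have bA := @bmeas_indic _ _ R _ mA.
  have bA2 := bmeasM bA b2.
  have bS := @bmeas_cst _ (measurableTypeR R) R (\sum_(i < n.+1) loc T H2 (x - i%:R * T)).
  have := le_mean_halfline H1_null b2 (bmeasD bS bA2).
  rewrite meanD// mean_cst -loc_conv -HE => H'.
  have {}H' : loc T H x <= \sum_(i < n.+1) loc T H2 (x - i%:R * T) +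
      \int[H1]_y (\1_`]A, +oo[%classic y * loc T H2 (x - y)).
    apply: H' => y y0; have [Ay|yA] := ltP A y.
      rewrite indicE mem_set/= ?in_itv/= ?Ay// mul1r lerDr.
      by apply: sumr_ge0 => i _; exact: loc_ge0.
    apply: (@le_trans _ _ (\sum_(i < n.+1) loc T H2 (x - i%:R * T))); last first.
      by rewrite lerDl mulr_ge0 ?loc_ge0// indicE ler0n.
    apply: le_trans _ (le_window_sum T H2 x n).
    apply: fine_prob_le; [exact: measurable_itv..|] => z/=.
    by rewrite !in_itv/= => /andP[? ?]; apply/andP; split; lra.
  lra.
(* With this error, the n + 1 terms contribute at most a quarter of the mass of H. *)
have c0 : 0 < 1 / (8 * (n.+1)%:R) :> R by rewrite divr_gt0// mulr_gt0// ltr0n.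
have terms : \forall x \near +oo, forall i : 'I_n.+1,
    loc T H2 (x + (n%:R * T - i%:R * T)) <=
    loc T H2 x + 1 / (8 * (n.+1)%:R) * (2 * loc T H x).
  apply: filter_forall => i; set s := n%:R * T - i%:R * T.
  have s0 : 0 <= s.
    by rewrite subr_ge0 ler_wpM2r ?(ltW T_gt0)// ler_nat -ltnS ltn_ord.
  have D := near_pinfty_shift s (loc_decr_H2 s0 c0).
  near=> x.
  have : loc T H2 (x + s) <= loc T H2 (x + s - s) +
    1 / (8 * (n.+1)%:R) * loc T H (x + s) by near: x.
  rewrite addrK => /le_trans; apply; rewrite lerD2l ler_wpM2l ?(ltW c0)//.
  have : `|loc T H (x + s) - loc T H x| <= 1 * loc T H x.
    by near: x; apply: class_L_shift => //; have [] := LOS_H.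
  by rewrite ler_norml => /andP[_]; lra.
have up' := near_pinfty_shift (n%:R * T) upper.
exists (8 * (n.+1)%:R); split; first by rewrite mulr_ge0.
near=> x.
have h1 : `|loc T H (x + n%:R * T) - loc T H x| <= 1 / 4 * loc T H x.
  by near: x; apply: class_L_shift; [have [] := LOS_H|lra].
have h2 : loc T H (x + n%:R * T) <=
  2 * \sum_(i < n.+1) loc T H2 (x + n%:R * T - i%:R * T) by near: x.
have h3 (i : 'I_n.+1) : loc T H2 (x + (n%:R * T - i%:R * T)) <=
    loc T H2 x + 1 / (8 * (n.+1)%:R) * (2 * loc T H x) by move: i; near: x.
have h4 : \sum_(i < n.+1) loc T H2 (x + n%:R * T - i%:R * T) <=
    n.+1%:R * (loc T H2 x + 1 / (8 * (n.+1)%:R) * (2 * loc T H x)).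
  apply: (@le_trans _ _ (\sum_(i < n.+1)
    (loc T H2 x + 1 / (8 * (n.+1)%:R) * (2 * loc T H x)))).
    by apply: ler_sum => i _; rewrite -addrA; exact: h3.
  by rewrite sumr_const card_ord [leRHS]mulr_natl.
have h5 : n.+1%:R * (loc T H2 x + 1 / (8 * (n.+1)%:R) * (2 * loc T H x)) =
    n.+1%:R * loc T H2 x + 1 / 4 * loc T H x.
  have : (n.+1%:R : R) != 0 by rewrite pnatr_eq0.
  by move: (n.+1%:R : R) => N N0; field.
move: h1; rewrite ler_norml => /andP[h1 _]; rewrite h5 in h4.
lra.
Unshelve. all: by end_near. Qed.

Lemma loc_H_double s : \forall x \near +oo, loc T H (x + s) <= 2 * loc T H x.
Proof.
have LH : class_L T H by have [] := LOS_H.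
have := class_L_shift s LH ltr01; apply: filterS => x.
by rewrite ler_norml => /andP[_]; lra.
Qed.

(** If [H2] dropped between [x - t] and [x] by more than a small multiple of [H], then
    by almost-monotonicity it would also drop between [x - t - y] and [x + A - y]
    for every [y] in [0, A]: the first point lies to the left of [x - t], the
    second one to the right of [x]. Widening the gap by [A] makes the drop
    uniform over a block that carries more than half of the mass of [H1], so [H] would
    drop between [x - t] and [x + A], against its membership in L. *)
Lemma loc_incr_H2 t e : 0 < t -> 0 < e ->
  \forall x \near +oo, loc T H2 (x - t) <= loc T H2 x + e * loc T H x.
Proof.
(* 12 = 2 + 2 (2 + 1 + 2): the first 2 is in the definition of D below; then come the
   increment of H, the exceptional set and the tail, doubled because half of D is
   absorbed by the mass of H1 beyond A. *)
move=> t0 e0; pose d := e / 12; have d0 : 0 < d by rewrite divr_gt0.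
have d2 : 0 < d / 2 by rewrite divr_gt0.
have half0 : (0 < 1 / 2 :> R) by lra.
have [A0 HA0] := H1_tail d0.
(* From A1 on, the block [0, A] carries more than half of the mass of H1. *)
have [A1 HA1] : exists A1, forall A, A1 <= A -> fine (H1 `]A, +oo[%classic) < 1 / 2.
  apply: near_pinfty_ex; apply: (prob_near_lt H1) => // y.
  near=> A; rewrite /= in_itv/= andbT; apply/negP; rewrite -leNgt.
  by near: A; apply: nbhs_pinfty_ge; rewrite num_real.
pose A := Num.max A0 A1.
have AA0 : A0 <= A by rewrite le_max lexx.
have AA1 : A1 <= A by rewrite le_max lexx orbT.
have [C1 [C10 HC1]] := loc_dom_window T_gt0 A regH loc_dom_H2.
have {}HC1 := near_pinfty_shift A HC1.
have [C2 [C20 HC2]] := loc_dom_shift regH loc_dom_H2 (ltW t0).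
(* The shifts at which almost-monotonicity has not set in yet. *)
pose B x : set (measurableTypeR R) := `[0, A]%classic `&`
  ((fun y : measurableTypeR R => loc T H2 (x - t - y)) @^-1`
     `]-oo, loc T H2 (x - t) - d * loc T H x[ `|`
   (fun y : measurableTypeR R => loc T H2 (x + A - y)) @^-1`
     `]loc T H2 x + d * loc T H x, +oo[%classic).
have mB x : measurable (B x).
  apply: measurableI; first exact: measurable_itv.
  apply: measurableU; rewrite -[X in measurable X]setTI.
    by have [mf _] := bmeas_loc T H2 (x - t); apply: mf => //; exact: measurable_itv.
  by have [mf _] := bmeas_loc T H2 (x + A); apply: mf => //; exact: measurable_itv.
have nB y : \forall x \near +oo, ~ B x y.
  have [/andP[y0 yA]|nyA] := boolP (0 <= y <= A); last first.
    by apply: nearW => x [/=]; rewrite in_itv/= (negPf nyA).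
  have D1 := near_pinfty_shift (- t) (loc_decr_H2 y0 d2).
  have yA0 : 0 <= A - y by rewrite subr_ge0.
  have D2 := near_pinfty_shift (A - y) (loc_decr_H2 yA0 d2).
  have h1 := loc_H_double (- t); have h2 := loc_H_double (A - y).
  near=> x => -[_].
  have D1x : loc T H2 (x - t) <= loc T H2 (x - t - y) + d / 2 * loc T H (x - t) by near: x.
  have D2x : loc T H2 (x + (A - y)) <= loc T H2 (x + (A - y) - (A - y)) +
    d / 2 * loc T H (x + (A - y)) by near: x.
  have h1x : loc T H (x - t) <= 2 * loc T H x by near: x.
  have h2x : loc T H (x + (A - y)) <= 2 * loc T H x by near: x.
  rewrite addrK in D2x; rewrite /= !in_itv/= andbT -(addrA x A (- y)).
  have k1 := ler_wpM2l (ltW d2) h1x; have k2 := ler_wpM2l (ltW d2) h2x.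
  by case; lra.
have Q0 : 0 < 2 * C1 + C2 + 1 by lra.
have K0 : 0 < d / (2 * C1 + C2 + 1) by rewrite divr_gt0.
have HB := prob_near_lt H1 mB nB K0.
have tA := near_pinfty_shift A (HA0 A AA0).
have LH : class_L T H by have [] := LOS_H.
have hA := class_L_shift A LH d0; have ht := class_L_shift (- t) LH d0.
have hA2 := loc_H_double A.
have IA := HA1 A AA1.
have facts : \forall x \near +oo,
    [/\ \int[H1]_y (\1_`]A, +oo[%classic y * loc T H2 (x + A - y)) <= d * loc T H (x + A),
      `|loc T H (x + A) - loc T H x| <= d * loc T H x,
      `|loc T H (x - t) - loc T H x| <= d * loc T H x &
      loc T H (x + A) <= 2 * loc T H x] /\
    [/\ fine (H2 `]x + A - A, x + A + T]%classic) <= C1 * loc T H (x + A),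
      loc T H2 (x - t) <= C2 * loc T H x &
      fine (H1 (B x)) < d / (2 * C1 + C2 + 1)].
  by near=> x; split; split; near: x.
apply: filterS facts => x [[tAx hAx htx hA2x] [Px tx Bx]].
move=> {HA0 HA1 HC1 HC2 nB HB tA hA ht hA2}; have h0 := loc_ge0 T H x.
set D := loc T H2 (x - t) - loc T H2 x - 2 * d * loc T H x.
have [D0|D0] := leP D 0.
  have : 2 * d * loc T H x <= e * loc T H x.
    by apply: ler_wpM2r => //; rewrite /d; lra.
  by move: D0; rewrite /D; lra.
have BA : B x `<=` `[0, A]%classic by move=> y [].
have := @loc_conv_gain _ T H1 H2 (B x) A t x D H1_null (mB x) BA (ltW D0).
rewrite -!HE; set P := fine (H2 _) in Px * => main.
have {}main : loc T H (x + A) + D <= loc T H (x - t) + (P + D) * fine (H1 (B x)) +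
    \int[H1]_y (\1_`]A, +oo[%classic y * loc T H2 (x + A - y)) +
    D * fine (H1 `]A, +oo[%classic).
  apply: main => y /andP[y0 yA] nBy; rewrite leNgt; apply/negP => lt_y; apply: nBy.
  split; rewrite /= ?in_itv/= ?y0 ?yA// andbT.
  have [|le1] := ltP (loc T H2 (x - t - y)) (loc T H2 (x - t) - d * loc T H x); first by left.
  by right; move: lt_y le1; rewrite /D; lra.
have Dt : D <= C2 * loc T H x.
  have := mulr_ge0 (ltW d0) h0; have := loc_ge0 T H2 x.
  by move: tx; rewrite /D; lra.
have PD : (P + D) * fine (H1 (B x)) <= d * loc T H x.
  have PDh : P + D <= (2 * C1 + C2 + 1) * loc T H x.
    by have := ler_wpM2l C10 hA2x; move: Px Dt h0; lra.
  have B0 : 0 <= fine (H1 (B x)) by exact: fine_prob_ge0.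
  apply: le_trans (ler_wpM2r B0 PDh) _.
  have Qh : 0 <= (2 * C1 + C2 + 1) * loc T H x := mulr_ge0 (ltW Q0) h0.
  apply: le_trans (ler_wpM2l Qh (ltW Bx)) _.
  rewrite le_eqVlt; apply/orP; left; apply/eqP; field.
  by rewrite gt_eqF.
have DI : D * fine (H1 `]A, +oo[%classic) <= D * (1 / 2).
  exact: (ler_wpM2l (ltW D0) (ltW IA)).
have dhA := ler_wpM2l (ltW d0) hA2x.
move: hAx htx; rewrite !ler_norml => /andP[hAx _] /andP[_ htx].
have : D <= 10 * d * loc T H x by move: main tAx hAx htx PD DI dhA; lra.
by rewrite /D /d; lra.
Unshelve. all: by end_near. Qed.

(** For a distribution [V] of the local order of [H], this is membership in the class L;
    measured against [H] it makes sense, and passes to the terms of the Poisson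
    series, before that order is known. *)
Definition loc_asymp_cst V := forall t e, 0 < t -> 0 < e ->
  \forall x \near +oo, `|loc T V (x - t) - loc T V x| <= e * loc T H x.

Lemma loc_asymp_cst_H2 : loc_asymp_cst H2.
Proof.
move=> t e t0 e0; have D := loc_decr_H2 (ltW t0) e0; have I := loc_incr_H2 t0 e0.
near=> x; rewrite ler_norml.
have Dx : loc T H2 x <= loc T H2 (x - t) + e * loc T H x by near: x.
have Ix : loc T H2 (x - t) <= loc T H2 x + e * loc T H x by near: x.
by apply/andP; split; lra.
Unshelve. all: by end_near. Qed.

(** The increments of [H2] are a weighted sum of those of the powers of [F]. The sum is
    negligible and no term is appreciably negative, so no term is appreciably
    positive. *)
Lemma loc_asymp_cst_Fk k : loc_asymp_cst (Fk k).
Proof.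
move=> t e t0 e0; have pk := poisson_weight_gt0 k m_gt0.
pose d := e * p k / 3; have d0 : 0 < d by rewrite divr_gt0// mulr_gt0.
have [N0 HN] := loc_H2_tail d0; pose N := (N0 + k.+1)%N.
have {}HN : \forall x \near +oo,
    loc T H2 x <= \sum_(j < N) p j * loc T (Fk j) x + d * loc T H x.
  by apply: HN; exact: leq_addr.
have all_j : \forall x \near +oo, forall j : 'I_N,
    loc T (Fk j) x <= loc T (Fk j) (x - t) + d * loc T H x.
  by apply: filter_forall => j; exact: loc_decr_Fk (ltW t0) d0.
have I := loc_incr_H2 t0 d0; have D := @loc_decr_Fk k t e (ltW t0) e0.
near=> x; have h0 := loc_ge0 T H x.
have Dx : loc T (Fk k) x <= loc T (Fk k) (x - t) + e * loc T H x by near: x.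
have Ix : loc T H2 (x - t) <= loc T H2 x + d * loc T H x by near: x.
have Nx : loc T H2 x <= \sum_(j < N) p j * loc T (Fk j) x + d * loc T H x by near: x.
have xj (j : 'I_N) : loc T (Fk j) x <= loc T (Fk j) (x - t) + d * loc T H x.
  by move: j; near: x.
have kN : (k < N)%N by rewrite /N addnS ltnS leq_addl.
have Nxt := loc_H2_ge N (x - t).
(* The weights of the other terms sum to at most one. *)
have others : \sum_(j < N | j != Ordinal kN) p j * loc T (Fk j) x <=
    \sum_(j < N | j != Ordinal kN) p j * loc T (Fk j) (x - t) + 1 * (d * loc T H x).
  apply: (@le_trans _ _ (\sum_(j < N | j != Ordinal kN)
      (p j * loc T (Fk j) (x - t) + p j * (d * loc T H x)))).
    apply: ler_sum => j _; rewrite -mulrDr; apply: ler_wpM2l => //.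
    exact: poisson_weight_ge0.
  rewrite big_split/= lerD2l -mulr_suml; apply: ler_wpM2r.
    by rewrite mulr_ge0// ltW.
  apply: le_trans (sum_weight_le1 N); rewrite [leRHS](bigD1 (Ordinal kN))//=.
  by rewrite lerDr ltW.
rewrite (bigD1 (Ordinal kN))//= in Nx; rewrite (bigD1 (Ordinal kN))//= in Nxt.
have {}main : p k * loc T (Fk k) (x - t) <= p k * (loc T (Fk k) x + e * loc T H x).
  have : 3 * d * loc T H x = p k * (e * loc T H x) by rewrite /d; field.
  by rewrite mulrDr; lra.
rewrite ler_pM2l// in main.
by rewrite ler_norml; apply/andP; split; lra.
Unshelve. all: by end_near. Qed.

Lemma loc_dom_Fk0 V : loc_dom T (Fk 0) V.
Proof.
exists 0; split => //; apply: filterS (nbhs_pinfty_ge (num_real 0)) => x x0.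
by rewrite loc_dirac// mul0r.
Qed.

Lemma loc_dom_FkS k : (1 <= k)%N -> loc_dom T (Fk k) (Fk k.+1).
Proof.
move=> k1; exists 4; split => //; have := loc_conv_lower F0 (hF k1).
by apply: filterS => x; rewrite subr0.
Qed.

Lemma loc_dom_Fk_le k n : (1 <= k)%N -> (k <= n)%N -> loc_dom T (Fk k) (Fk n).
Proof.
move=> k1; elim: n => [|n IH]; first by rewrite leqn0 => /eqP k0; rewrite k0 in k1.
rewrite leq_eqVlt => /predU1P[->|]; first exact: loc_dom_refl.
by rewrite ltnS => kn; apply: loc_dom_trans (IH kn) _; apply: loc_dom_FkS; exact: leq_trans kn.
Qed.

(** The tail of the Poisson series accounts for at most half of [H], and in the
    remaining finite sum the last power dominates all others. *)
Lemma ex_loc_dom_H_Fk : exists n, (1 <= n)%N /\ loc_dom T H (Fk n).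
Proof.
have [C [C0 HC]] := loc_dom_H; pose d := 1 / (2 * (C + 1)).
have d0 : 0 < d by rewrite divr_gt0//; lra.
have [N HN] := loc_H2_tail d0.
pose M := N.+1; have {}HN := HN M (leqnSn N).
exists M; split => //.
have partial k : (k <= M)%N -> exists D, 0 <= D /\ \forall x \near +oo,
    \sum_(j < k) p j * loc T (Fk j) x <= D * loc T (Fk M) x.
  elim: k => [_|k IH kM].
    by exists 0; split => //; apply: nearW => x; rewrite big_ord0 mul0r.
  have [D [D0 HD]] := IH (ltnW kM).
  have [E [E0 HE']] : loc_dom T (Fk k) (Fk M).
    case: (k) kM => [_|j jM]; first exact: loc_dom_Fk0.
    by apply: loc_dom_Fk_le => //; exact: ltnW.
  exists (D + p k * E); split; first by rewrite addr_ge0// mulr_ge0// poisson_weight_ge0.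
  near=> x; rewrite big_ord_recr/= mulrDl; apply: lerD; first by near: x.
  rewrite -[p k * E * _]mulrA; apply: ler_wpM2l; first exact: poisson_weight_ge0.
  by near: x.
have [D [D0 HD]] := partial M (leqnn M).
exists (2 * C * D); split; first by rewrite !mulr_ge0.
near=> x; have h0 := loc_ge0 T H x.
have h1 : loc T H x <= C * loc T H2 x by near: x.
have h2 : loc T H2 x <= \sum_(j < M) p j * loc T (Fk j) x + d * loc T H x by near: x.
have h3 : \sum_(j < M) p j * loc T (Fk j) x <= D * loc T (Fk M) x by near: x.
have h4 : loc T H2 x <= D * loc T (Fk M) x + d * loc T H x by lra.
have h5 := ler_wpM2l C0 h4.
have : C * (d * loc T H x) <= 1 / 2 * loc T H x.
  rewrite mulrA ler_wpM2r// /d mulrA mulr1 ler_pdivrMr; lra.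
lra.
Unshelve. all: by end_near. Qed.

Lemma class_LOS_of_dom (V : distr R) : onR0 V -> loc_dom T V H -> loc_dom T H V ->
  loc_asymp_cst V -> class_LOS T V.
Proof.
move=> V0 VH HV cV; have [C [C0 HC]] := HV; have [pH _ _] := regH.
have pV : loc_pos T V.
  near=> x; have hx : 0 < loc T H x by near: x.
  have xC : loc T H x <= C * loc T V x by near: x.
  rewrite lt_neqAle loc_ge0 andbT; apply/eqP => v0.
  by move: (lt_le_trans hx xC); rewrite -v0 mulr0 ltxx.
split.
  apply/class_LE; split => // t e t0 e0.
  have eC : 0 < e / (C + 1) by rewrite divr_gt0//; lra.
  have cVt := cV t _ t0 eC; near=> x.
  have xC : loc T H x <= C * loc T V x by near: x.
  apply: (@le_trans _ _ (e / (C + 1) * loc T H x)); first by near: x.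
  apply: le_trans (ler_wpM2l (ltW eC) xC) _.
  have v0 := loc_ge0 T V x.
  rewrite mulrAC ler_pdivrMr; last lra.
  rewrite -mulrA ler_wpM2l ?(ltW e0)//; lra.
apply/class_OSE; split => //.
exact: loc_dom_trans (loc_dom_conv T_gt0 regH V0 V0 VH VH) HV.
Unshelve. all: by end_near. Qed.

Theorem class_LOS_H2 : class_LOS T H2.
Proof.
exact: class_LOS_of_dom H2_null loc_dom_H2 loc_dom_H loc_asymp_cst_H2.
Qed.

Lemma class_LOS_Fk n : loc_dom T H (Fk n) -> class_LOS T (Fk n).
Proof.
by move=> HF; apply: class_LOS_of_dom; [exact: Fk0|exact: loc_dom_Fk| |exact: loc_asymp_cst_Fk].
Qed.

Theorem class_LOS_Fk_eventually : exists n0, (1 <= n0)%N /\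
  forall n, (n0 <= n)%N -> class_LOS T (Fk n).
Proof.
have [n0 [n1 HF]] := ex_loc_dom_H_Fk; exists n0; split => // n n0n.
by apply: class_LOS_Fk; apply: loc_dom_trans HF _; exact: loc_dom_Fk_le.
Qed.

(** Since [F] charges only ]1, +oo[, each convolution square dominates the shift by
    one. Class OS thus bounds the shift by one, and iterating it bounds all shifts;
    this replaces the insensitivity to shifts, which is not known at this
    point. *)
Lemma class_OS_Fk_regular l : (1 <= l)%N -> class_OS T (Fk l) -> loc_regular T (Fk l).
Proof.
move=> l1 /class_OSE[pV dV]; split => // s s0.
have [C [C0 HC]] := dV.
have V1 : Fk l `]-oo, 1%R[%classic = 0%E by exact: convolution_pow_null.
have low := loc_conv_lower V1 (hF l1).
have [n sn] : exists n, s <= n%:R.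
  by exists (Num.trunc s).+1; rewrite ltW// truncnS_gt.
have [K [K0 HK]] : exists K, 0 <= K /\
    \forall x \near +oo, loc T (Fk l) (x - n%:R) <= K * loc T (Fk l) x.
  elim: (n) => [|k [K [K0 HK]]].
    by exists 1; split => //; apply: nearW => x; rewrite subr0 mul1r.
  exists (4 * C * K); split; first by rewrite !mulr_ge0.
  have low' := near_pinfty_shift (- k%:R) low; have HC' := near_pinfty_shift (- k%:R) HC.
  near=> x; rewrite -natr1 opprD addrA.
  have h1 : loc T (Fk l) (x - k%:R - 1) <=
    4 * loc T (convolution (Fk l) (Fk l)) (x - k%:R) by near: x.
  have h2 : loc T (convolution (Fk l) (Fk l)) (x - k%:R) <=
    C * loc T (Fk l) (x - k%:R) by near: x.
  have h3 : loc T (Fk l) (x - k%:R) <= K * loc T (Fk l) x by near: x.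
  by have := ler_wpM2l C0 h3; lra.
have ns0 : 0 <= n%:R - s by rewrite subr_ge0.
have half0 : (0 < 1 / 2 :> R) by lra.
have dec := near_pinfty_shift (- s) (loc_liminf_ge1_decr (hF l1) ns0 half0).
exists (2 * K); split; first by rewrite mulr_ge0.
near=> x.
have h1 : (1 - 1 / 2) * loc T (Fk l) (x - s) <= loc T (Fk l) (x - s - (n%:R - s)) by near: x.
have h2 : loc T (Fk l) (x - n%:R) <= K * loc T (Fk l) x by near: x.
rewrite (_ : x - s - (n%:R - s) = x - n%:R) in h1; last by ring.
lra.
Unshelve. all: by end_near. Qed.

(** Domination by the [l]-th power is stable under convolution, and this power
    dominates [F]. Hence it dominates every power of [F], among them one that dominates
    [H]. *)
Theorem class_LOS_Fk_of_OS l n : (1 <= l)%N -> class_OS T (Fk l) -> (l <= n)%N ->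
  class_LOS T (Fk n).
Proof.
move=> l1 OSl ln; have rV := class_OS_Fk_regular l1 OSl.
have F1 : loc_dom T F (Fk l) := loc_dom_eq loc_Fk1 (loc_dom_Fk_le (leqnn 1) l1).
have Fj j : loc_dom T (Fk j) (Fk l).
  elim: j => [|j IH]; first exact: loc_dom_Fk0.
  exact (loc_dom_conv T_gt0 rV F0 (Fk0 j) F1 IH).
have [N [_ HN]] := ex_loc_dom_H_Fk.
apply: class_LOS_Fk; apply: loc_dom_trans HN _; apply: loc_dom_trans (Fj N) _.
exact: loc_dom_Fk_le.
Qed.

(** [F] and its first convolution power agree on windows, but they are different
    terms. *)
Theorem class_LOS_F_of_OS : class_OS T F -> class_LOS T F.
Proof.
have E : loc T (Fk 1) = loc T F by apply/funext => x; exact: loc_Fk1.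
have EC x : loc T (convolution (Fk 1) (Fk 1)) x = loc T (convolution F F) x.
  transitivity (loc T (convolution (Fk 1) F) x).
    by rewrite !loc_conv; apply: eq_Rintegral => y _; rewrite loc_Fk1.
  by rewrite loc_convC !loc_conv; apply: eq_Rintegral => y _; rewrite loc_Fk1.
move=> /class_OSE[pF [C [C0 HC]]].
have OS1 : class_OS T (Fk 1).
  apply/class_OSE; rewrite /loc_pos /loc_dom E; split => //.
  by exists C; split => //; apply: filterS HC => x; rewrite EC.
have [L1 _] := class_LOS_Fk_of_OS (leqnn 1) OS1 (leqnn 1).
split; first by rewrite /class_L /loc_pos -E.
by apply/class_OSE; split => //; exists C.
Qed.

End poisson_mixture.

Theorem theorem4p3 (R : realType) (a : R)
    (upsilon : {measure set (measurableTypeR R) -> \bar R})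
    (H H1 : distr R) (T : R)
    (F := levy_spectral upsilon)
    (H2 : distr R := compound_poisson (levy_mass upsilon) F)
    (hdata : levy_data a upsilon)
    (hH : inf_div_law a upsilon H)
    (hH1 : inf_div_law a (small_jumps upsilon) H1)
    (hdec : eq_distr H (convolution H1 H2))
    (hT : 0 < T)
    (hF : forall k, (1 <= k)%N -> loc_liminf_ge1 T (convolution_pow F k))
    (hH12 : loc T H1 =o_ (pinfty_nbhs R) loc T H2)
    (hLOS : class_LOS T H) :
  [/\ class_LOS T H2,
      asymp_equiv (loc T H2) (loc T H),
      exists n0, [/\ (1 <= n0)%N,
        forall n, (n0 <= n)%N -> class_LOS T (convolution_pow F n) &
        (2 <= n0)%N -> forall l0, (1 <= l0 <= n0 - 1)%N ->
          class_OS T (convolution_pow F l0) ->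
          forall n, (l0 <= n)%N -> class_LOS T (convolution_pow F n)] &
      class_OS T F -> class_LOS T F].
Proof.
have m_gt0 := levy_mass_gt0 hdata; have F_null := levy_spectral_null hdata.
have [_ H_null _] := hH; have [_ H1_null _] := hH1.
have HE x : loc T H x = loc T (convolution H1 H2) x.
  by rewrite /loc hdec//; exact: measurable_itv.
have H12 e (e0 : 0 < e) := loc_eqo_le hH12 e0.
split.
- exact: (class_LOS_H2 hT m_gt0 F_null H_null H1_null HE hF H12 hLOS).
- split; apply: loc_dom_eqO.
    exact: (loc_dom_H2 hT m_gt0 F_null H_null H1_null HE hF hLOS).
  exact: (loc_dom_H hT m_gt0 F_null H_null H1_null HE hF H12 hLOS).
- have [n0 [n1 LOS_n]] :=
    class_LOS_Fk_eventually hT m_gt0 F_null H_null H1_null HE hF H12 hLOS.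
  exists n0; split => // _ l0 /andP[l1 _] OSl n ln.
  exact: (class_LOS_Fk_of_OS hT m_gt0 F_null H_null H1_null HE hF H12 hLOS l1 OSl ln).
- exact: (class_LOS_F_of_OS hT m_gt0 F_null H_null H1_null HE hF H12 hLOS).
Qed.
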